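(* Let $k\ge 2$ and $n\ge 2$ be integers, and let $f:(\mathbb{C}^n,0)\to(\mathbb{C}^n,0)$ be a $k$-fold associated with a reflection $\varphi$ on $(\mathbb{C}^n,0)$ of order $k$. Then a $k$-fold $g:(\mathbb{C}^n,0)\to(\mathbb{C}^n,0)$ is associated with $\varphi$ if and only if $g$ is $\mathcal{L}$-equivalent to $f$.
   Context: All maps are germs at $0$ of holomorphic maps $(\mathbb{C}^n,0)\to(\mathbb{C}^n,0)$ (fixing $0$). A (complex) reflection is a germ of biholomorphism $\varphi:(\mathbb{C}^n,0)\to(\mathbb{C}^n,0)$ of finite order $r\ge 2$ whose fixed-point set $\mathrm{Fix}(\varphi)=\{x:\varphi(x)=x\}$ is a submanifold (germ) of codimension $1$; it need not be linear. A $k$-fold ($k\ge2$) is a holomorphic germ $f:(\mathbb{C}^n,0)\to(\mathbb{C}^n,0)$ which is $\mathcal{A}$-equivalent to $f_1(x_1,\dots,x_n)=(x_1^k,x_2,\dots,x_n)$, that is, $f=l\circ f_1\circ h^{-1}$ for some germs of biholomorphisms $h,l$ of $(\mathbb{C}^n,0)$. A $k$-fold $f$ is associated with a reflection $\varphi$ if $f\circ\varphi=f$. Two germs $f,g$ are $\mathcal{L}$-equivalent if $g=l\circ f$ for some germ of biholomorphism $l$ of $(\mathbb{C}^n,0)$. *)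

(* Defs.v *)
From HB Require Import structures.
From mathcomp Require Import all_boot all_order all_algebra.
From mathcomp Require Import all_classical all_reals all_analysis.
From mathcomp Require Export complex.

Set Implicit Arguments.
Unset Strict Implicit.
Unset Printing Implicit Defensive.

Import Order.TTheory GRing.Theory Num.Theory.
Import numFieldNormedType.Exports.

Local Open Scope classical_set_scope.
Local Open Scope ring_scope.

(** The library equips only abstract number fields with their topology; these
    instances are transported to the complex numbers R[i]. *)
HB.instance Definition _ (R : realType) := NormedModule.copy R[i] R[i]^o.

Notation "''CC[' R ]_ n" := 'rV[R[i]]_n
  (at level 8, R at level 200, n at level 2, format "''CC[' R ]_ n").

(** A germ at 0 is handled through a representative, a total function on C^n
    whose values matter only near 0. Germs are compared with [germ_eq], and every
    notion below depends only on the germs of the functions it is applied to.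
    As all germs fix 0 and are continuous there, composition of representatives
    represents composition of germs. *)

Definition germ_eq (R : realType) (n : nat) (f g : 'CC[R]_n -> 'CC[R]_n) : Prop :=
  \forall x \near (0 : 'CC[R]_n), f x = g x.

(** The scalar field of the normed module is R[i], so that [differentiable] is
    complex (Frechet) differentiability. *)
Definition holo_germ (R : realType) (n : nat) (f : 'CC[R]_n -> 'CC[R]_n) : Prop :=
  f 0 = 0 /\ \forall x \near (0 : 'CC[R]_n), differentiable f x.

Definition inverse_germs (R : realType) (n : nat) (h h' : 'CC[R]_n -> 'CC[R]_n) : Prop :=
  [/\ holo_germ h, holo_germ h', germ_eq (h' \o h) id & germ_eq (h \o h') id].

Definition biholo_germ (R : realType) (n : nat) (h : 'CC[R]_n -> 'CC[R]_n) : Prop :=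
  exists h', inverse_germs h h'.

(** The germ at 0 of the set S is a complex submanifold of codimension d:
    some biholomorphic change of coordinates straightens it to
    x_1 = ... = x_d = 0. *)
Definition submanifold_germ (R : realType) (n d : nat) (S : set 'CC[R]_n) : Prop :=
  (d <= n)%N /\
  exists2 psi : 'CC[R]_n -> 'CC[R]_n, biholo_germ psi &
    \forall x \near (0 : 'CC[R]_n),
      S x <-> forall j : 'I_n, (j < d)%N -> psi x 0 j = 0.

Definition Fix (R : realType) (n : nat) (phi : 'CC[R]_n -> 'CC[R]_n) : set 'CC[R]_n :=
  [set x | phi x = x].

Definition germ_order (R : realType) (n r : nat) (phi : 'CC[R]_n -> 'CC[R]_n) : Prop :=
  [/\ (0 < r)%N, germ_eq (iter r phi) id &
      forall m, (0 < m < r)%N -> ~ germ_eq (iter m phi) id].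

Definition reflection (R : realType) (n : nat) (phi : 'CC[R]_n -> 'CC[R]_n) : Prop :=
  [/\ biholo_germ phi, exists2 r, (2 <= r)%N & germ_order r phi &
      submanifold_germ 1 (Fix phi)].

(** (x_1, ..., x_n) |-> (x_1 ^ k, x_2, ..., x_n); the coordinate x_1 has index 0. *)
Definition std_fold (R : realType) (n k : nat) (x : 'CC[R]_n) : 'CC[R]_n :=
  \row_j (if val j == 0%N then x 0 j ^+ k else x 0 j).

Definition kfold (R : realType) (n k : nat) (f : 'CC[R]_n -> 'CC[R]_n) : Prop :=
  [/\ (2 <= k)%N, holo_germ f &
      exists h h' l : 'CC[R]_n -> 'CC[R]_n,
        [/\ inverse_germs h h', biholo_germ l &
            germ_eq f (l \o @std_fold R n k \o h')]].

Definition associated (R : realType) (n : nat) (f phi : 'CC[R]_n -> 'CC[R]_n) : Prop :=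
  germ_eq (f \o phi) f.

Definition L_equivalent (R : realType) (n : nat) (f g : 'CC[R]_n -> 'CC[R]_n) : Prop :=
  exists2 l : 'CC[R]_n -> 'CC[R]_n, biholo_germ l & germ_eq g (l \o f).

(* Main.v *)
(** Choose coordinates in which [f] is the standard fold. There [phi] preserves
    the standard fold, so it multiplies [x_1] by a k-th root of unity depending
    holomorphically on [x], that is by a constant [om], which is primitive because
    [phi] has order [k]. A germ [g] invariant under [phi] therefore depends on
    [x_1] through [x_1 ^ k] only, and [g = M o f] with [M] holomorphic: off
    [y_1 = 0] by local k-th roots, on [y_1 = 0] by the removable singularity
    theorem. By symmetry [f = M' o g], and since folds are locally onto, [M] and
    [M'] are mutually inverse.

    The complex analysis rests on Goursat's theorem, proved with midpoint sums
    and ultralimits instead of integrals. It makes every differentiable function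
    the derivative of one with second order Taylor expansions, for which the
    maximum principle is an elementary second order comparison; the Cauchy
    estimates and removability of singularities follow from the maximum principle
    applied to slopes. *)
Require Import Defs.
From mathcomp Require Import all_boot all_order all_algebra.
From mathcomp Require Import all_classical all_reals all_analysis.
From mathcomp Require Import ring lra.

Set Implicit Arguments.
Unset Strict Implicit.
Unset Printing Implicit Defensive.

Import Order.TTheory GRing.Theory Num.Theory.
Import numFieldNormedType.Exports.

Local Open Scope ring_scope.
Local Open Scope classical_set_scope.
Local Open Scope complex_scope.

(** * Modulus and ultralimits *)

(** The obstacle is to get Cauchy estimates from mere complex differentiability, without integrals
    or power series. A pointwise first derivative is too weak for a second order comparison, so the
    maximum principle is applied one level up. Goursat gives a primitive [F] of [f], and
    differentiability of [f] at a point becomes an expansion of [F] to order two there. The slope of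
    [F] at [w] keeps such expansions away from [w] and retains only a first derivative at [w], so
    the maximum principle must tolerate one exceptional point. It bounds the Lipschitz constant of
    [F] by its supremum alone. Applied to difference quotients of [F], with a constant independent
    of the step, this bound passes to [f] itself.

    Limits along a free ultrafilter exist for every bounded sequence. This replaces convergence of
    the midpoint sums, and it also provides the limit points that compactness or completeness would
    give. *)

Section Modulus.
Variable R : realType.
Implicit Types (x y z : R[i]) (t : R).

(** The norm of [R[i]] takes values in [R[i]], whose order is only partial. A modulus in [R] gives
    access to suprema and linear arithmetic. *)
Definition cmod z : R := Normc.normc z.

Lemma normE z : `|z| = (cmod z)%:C.
Proof. by []. Qed.

Lemma cmod0 : cmod 0 = 0. Proof. exact: Normc.normc0. Qed.
Lemma cmod1 : cmod 1 = 1. Proof. exact: Normc.normc1. Qed.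
Lemma cmodM x y : cmod (x * y) = cmod x * cmod y. Proof. exact: Normc.normcM. Qed.
Lemma cmodV x : cmod x^-1 = (cmod x)^-1. Proof. exact: Normc.normcV. Qed.
Lemma cmodf x y : cmod (x / y) = cmod x / cmod y. Proof. by rewrite cmodM cmodV. Qed.
Lemma cmodN x : cmod (- x) = cmod x. Proof. exact: normcN. Qed.
Lemma cmodD x y : cmod (x + y) <= cmod x + cmod y. Proof. exact: le_normcD. Qed.
Lemma cmodB x y : cmod (x - y) <= cmod x + cmod y.
Proof. by rewrite -(cmodN y) cmodD. Qed.
Lemma cmodBC x y : cmod (x - y) = cmod (y - x).
Proof. by rewrite -cmodN opprB. Qed.
Lemma cmod_tri y x z : cmod (x - z) <= cmod (x - y) + cmod (y - z).
Proof. by rewrite (le_trans _ (cmodD _ _))// addrA subrK. Qed.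
Lemma cmod_sub x y : cmod x <= cmod (x - y) + cmod y.
Proof. by rewrite (le_trans _ (cmodD _ _))// subrK. Qed.
Lemma cmodX x n : cmod (x ^+ n) = cmod x ^+ n.
Proof. by elim: n => [|n IH]; rewrite ?expr0 ?cmod1// !exprS cmodM IH. Qed.
Lemma cmod_ge0 z : 0 <= cmod z.
Proof. by rewrite -ler0c -normE normr_ge0. Qed.
Lemma cmod_eq0 z : (cmod z == 0) = (z == 0).
Proof. by apply/eqP/eqP => [/Normc.eq0_normc|->]//; exact: cmod0. Qed.
Lemma cmod_gt0 z : (0 < cmod z) = (z != 0).
Proof. by rewrite lt_def cmod_eq0 cmod_ge0 andbT. Qed.
Lemma cmod_le0 z : (cmod z <= 0) = (z == 0).
Proof. by rewrite -cmod_eq0 eq_le cmod_ge0 andbT. Qed.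
Lemma cmod_real t : cmod t%:C = `|t|.
Proof. by rewrite /cmod /= expr0n /= addr0 sqrtr_sqr. Qed.
Lemma cmod_nat n : cmod n%:R = n%:R.
Proof. by rewrite -(rmorph_nat (real_complex R)) cmod_real normr_nat. Qed.
Lemma cmod_i : cmod 'i = 1.
Proof. by rewrite /cmod /= expr0n /= add0r expr1n sqrtr1. Qed.
Lemma cmod_sqr z : cmod z ^+ 2 = complex.Re z ^+ 2 + complex.Im z ^+ 2.
Proof. by case: z => a b; rewrite /cmod /= sqr_sqrtr // addr_ge0 // sqr_ge0. Qed.
Lemma cmod_ReIm z : cmod z <= `|complex.Re z| + `|complex.Im z|.
Proof.
have := normr_ge0 (complex.Re z); have := normr_ge0 (complex.Im z) => hI hR.
rewrite -(@ler_pXn2r _ 2) ?nnegrE ?cmod_ge0 ?addr_ge0//.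
rewrite cmod_sqr -[complex.Re z ^+ 2]real_normK ?num_real//.
by rewrite -[complex.Im z ^+ 2]real_normK ?num_real//; nra.
Qed.
Lemma Re_cmod z : `|complex.Re z| <= cmod z.
Proof.
rewrite -(@ler_pXn2r _ 2) ?nnegrE ?cmod_ge0 ?normr_ge0// cmod_sqr.
by rewrite real_normK ?num_real// lerDl sqr_ge0.
Qed.
Lemma Im_cmod z : `|complex.Im z| <= cmod z.
Proof.
rewrite -(@ler_pXn2r _ 2) ?nnegrE ?cmod_ge0 ?normr_ge0// cmod_sqr.
by rewrite real_normK ?num_real// lerDr sqr_ge0.
Qed.

Lemma le_eps_le (a b : R) : (forall e, 0 < e -> a <= b + e) -> a <= b.
Proof. by move=> h; apply/ler_addgt0Pr => e /h. Qed.

End Modulus.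
Arguments cmod : simpl never.

Section Ultralimit.
Variable R : realType.
Variable U : set_system nat.
Hypothesis ultraU : UltraFilter U.
Hypothesis U_oo : \oo `<=` U.
Let FU : ProperFilter U := @ultra_proper _ _ ultraU.

Definition ulim (s : nat -> R[i]) (l : R[i]) :=
  forall e : R, 0 < e -> U [set n | cmod (s n - l) < e].

Lemma ulim_real (t : nat -> R) M : (forall n, `|t n| <= M) ->
  exists l, forall e : R, 0 < e -> U [set n | `|t n - l| < e].
Proof.
(* The limit is [sup E]. Since [sup E + e] is outside [E], the ultrafilter contains the
   complementary set of indices, which gives the upper bound. *)
move=> tM; pose E := [set x : R | U [set n | x <= t n]].
have E0 : E (- M) by apply: filterE => n /=; have := tM n; rewrite ler_norml => /andP[].
have ubE : ubound E M.
  move=> x Ex; have [n /= xn] := filter_ex Ex.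
  by rewrite (le_trans xn)// (le_trans (ler_norm _))// tM.
have hsE : has_sup E by split; [exists (- M)|exists M].
exists (sup E) => e e0.
have [x Ex xs] := sup_adherent e0 hsE.
have nE : ~ E (sup E + e).
  by move=> /(sup_upper_bound hsE); rewrite gerDl leNgt e0.
have [//|nU] := in_ultra_setVsetC [set n | sup E + e <= t n] ultraU.
apply: filterS (filterI Ex nU) => n /= [xn /negP]; rewrite -ltNge => tn.
by rewrite ltr_norml; apply/andP; split; lra.
Qed.

Lemma ulim_ex (s : nat -> R[i]) M : (forall n, cmod (s n) <= M) -> exists l, ulim s l.
Proof.
move=> sM.
have [a ha] := @ulim_real (fun n => complex.Re (s n)) M (fun n => le_trans (Re_cmod _) (sM n)).
have [b hb] := @ulim_real (fun n => complex.Im (s n)) M (fun n => le_trans (Im_cmod _) (sM n)).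
exists (a +i* b) => e e0; have e2 : 0 < e / 2 by lra.
apply: filterS (filterI (ha _ e2) (hb _ e2)) => n /= [h1 h2].
rewrite (le_lt_trans (cmod_ReIm _))//.
case: (s n) h1 h2 => x y /= h1 h2; lra.
Qed.

Lemma ulim_le s l c B : ulim s l -> U [set n | cmod (s n - c) <= B] ->
  cmod (l - c) <= B.
Proof.
move=> sl sB; apply: le_eps_le => e e0.
have [n /= [h1 h2]] := filter_ex (filterI (sl e e0) sB).
rewrite (le_trans (cmod_tri (s n) _ _))// addrC lerD// cmodBC; exact: ltW.
Qed.

Lemma U_ge N : U [set n | (N <= n)%N].
Proof. by apply: U_oo; exists N. Qed.

End Ultralimit.

Lemma free_ultrafilter : exists U : set_system nat, UltraFilter U /\ \oo `<=` U.
Proof. exact: ultraFilterLemma eventually_filter. Qed.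

(** * Primitives of differentiable functions *)

Section Goursat.
Variable R : realType.
Implicit Types (a b c z w h : R[i]) (D : set R[i]) (f : R[i] -> R[i]).

Definition cder f z a := forall e : R, 0 < e -> exists2 d : R, 0 < d &
  forall h, cmod h < d -> cmod (f (z + h) - f z - a * h) <= e * cmod h.

(* Midpoint sums for the integral of [f dz] over the segment from [a] to [b]:
   exact on affine functions, and additive when the segment is halved. *)
Fixpoint msum f n a b : R[i] :=
  if n is n'.+1 then msum f n' a ((a + b) / 2) + msum f n' ((a + b) / 2) b
  else (b - a) * f ((a + b) / 2).

Lemma msumC f n a b : msum f n b a = - msum f n a b.
Proof.
elim: n a b => [|n IH] a b /=; first by rewrite (addrC b a); ring.
by rewrite (addrC b a) IH (IH a); ring.
Qed.

(** Midpoint sums evaluate [f] only at iterated midpoints, so this weak form of convexity is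
    enough. *)
Definition midconvex D := forall x y, D x -> D y -> D ((x + y) / 2).

Lemma cmod_half z : cmod (z / 2) = cmod z / 2.
Proof. by rewrite cmodf cmod_nat. Qed.

Lemma midconvex_ball z (e : R) : midconvex [set w | cmod (w - z) <= e].
Proof.
move=> x y /= hx hy.
have -> : (x + y) / 2 - z = (x - z) / 2 + (y - z) / 2 by field.
by rewrite (le_trans (cmodD _ _))// !cmod_half; lra.
Qed.

(** The subtracted term is the exact integral of [al + be * w]. It is additive under halving, as is
    the length [cmod (b - a)], so only the undivided segment has to be checked. *)
Lemma msum_affine f D (al be : R[i]) (B : R) : midconvex D ->
  (forall w, D w -> cmod (f w - (al + be * w)) <= B) ->
  forall n a b, D a -> D b ->
  cmod (msum f n a b - (al * (b - a) + be * (b ^+ 2 - a ^+ 2) / 2)) <= B * cmod (b - a).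
Proof.
move=> mD fD; elim=> [|n IH] a b Da Db /=.
  have -> : (b - a) * f ((a + b) / 2) - (al * (b - a) + be * (b ^+ 2 - a ^+ 2) / 2) =
    (f ((a + b) / 2) - (al + be * ((a + b) / 2))) * (b - a) by field.
  by rewrite cmodM ler_wpM2r ?cmod_ge0// fD//; exact: mD.
set m := (a + b) / 2; have Dm : D m by exact: mD.
have -> : cmod (b - a) = cmod (b - m) + cmod (m - a).
  have -> : b - m = (b - a) / 2 by rewrite /m; field.
  have -> : m - a = (b - a) / 2 by rewrite /m; field.
  by rewrite cmod_half; lra.
rewrite [leRHS]mulrDr (le_trans _ (lerD (IH m b Dm Db) (IH a m Da Dm)))//.
rewrite (le_trans _ (cmodD _ _))// le_eqVlt; apply/orP; left; apply/eqP; congr cmod.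
by field.
Qed.

Definition tsum f n a b c := msum f n a b + msum f n b c + msum f n c a.

(** The sides of the medial triangle are run through twice in opposite directions and cancel by
    [msumC]. *)
Lemma tsumS f n a b c : let ab := (a + b) / 2 in let bc := (b + c) / 2 in
  let ca := (c + a) / 2 in
  tsum f n.+1 a b c = tsum f n a ab ca + tsum f n ab b bc + tsum f n ca bc c
    + tsum f n bc ca ab.
Proof.
move=> ab bc ca; rewrite /tsum /= -/ab -/bc -/ca.
by rewrite (msumC f n ca ab) (msumC f n ab bc) (msumC f n bc ca); ring.
Qed.

(* Goursat's bisection runs on the sums that stay large along infinitely many
   subdivision levels [n], so that no limit of the sums is needed. *)
Definition large_tsum f (e : R) a b c := forall N, exists2 n, (N <= n)%N & e < cmod (tsum f n a b c).

Lemma not_large_tsum f e a b c : ~ large_tsum f e a b c ->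
  exists N, forall n, (N <= n)%N -> cmod (tsum f n a b c) <= e.
Proof.
move=> /existsNP[N nN]; exists N => n Nn; rewrite leNgt; apply/negP => h.
by apply: nN; exists n.
Qed.

Definition small_triangle D (d : R) a b c := [/\ D a, D b & D c] /\
  [/\ cmod (a - b) <= d, cmod (b - c) <= d & cmod (c - a) <= d].

(** If the sums of all four subtriangles were eventually at most [e / 4], those of the whole
    triangle would eventually be at most [e]. *)
Lemma large_tsum_bisect f D d e a b c : midconvex D -> small_triangle D d a b c -> large_tsum f e a b c ->
  exists a' b' c', [/\ small_triangle D (d / 2) a' b' c', large_tsum f (e / 4) a' b' c' & cmod (a' - a) <= d].
Proof.
move=> mD [[Da Db Dc] [hab hbc hca]] bd.
pose ab := (a + b) / 2; pose bc := (b + c) / 2; pose ca := (c + a) / 2.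
have Dab : D ab by exact: mD.
have Dbc : D bc by exact: mD.
have Dca : D ca by exact: mD.
have hh u v x : cmod (u - v) <= d -> x = (u - v) / 2 -> cmod x <= d / 2.
  by move=> h ->; rewrite cmod_half; lra.
have hh' u v x : cmod (u - v) <= d -> x = - ((u - v) / 2) -> cmod x <= d / 2.
  by move=> h ->; rewrite cmodN cmod_half; lra.
have d0 : 0 <= d by rewrite (le_trans _ hab)// cmod_ge0.
have [b1|/not_large_tsum[N1 n1]] := pselect (large_tsum f (e / 4) a ab ca).
  exists a, ab, ca; split => //; last by rewrite subrr cmod0.
  split; split => //.
  - by apply: (hh _ _ _ hab); rewrite /ab; field.
  - by apply: (hh _ _ _ hbc); rewrite /ab /ca; field.
  - by apply: (hh _ _ _ hca); rewrite /ca; field.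
have [b2|/not_large_tsum[N2 n2]] := pselect (large_tsum f (e / 4) ab b bc).
  exists ab, b, bc; split => //; last first.
    by rewrite (@le_trans _ _ (d / 2))//; [apply: (hh' _ _ _ hab); rewrite /ab; field|lra].
  split; split => //.
  - by apply: (hh _ _ _ hab); rewrite /ab; field.
  - by apply: (hh _ _ _ hbc); rewrite /bc; field.
  - by apply: (hh _ _ _ hca); rewrite /ab /bc; field.
have [b3|/not_large_tsum[N3 n3]] := pselect (large_tsum f (e / 4) ca bc c).
  exists ca, bc, c; split => //; last first.
    by rewrite (@le_trans _ _ (d / 2))//; [apply: (hh _ _ _ hca); rewrite /ca; field|lra].
  split; split => //.
  - by apply: (hh _ _ _ hab); rewrite /ca /bc; field.
  - by apply: (hh _ _ _ hbc); rewrite /bc; field.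
  - by apply: (hh _ _ _ hca); rewrite /ca; field.
have [b4|/not_large_tsum[N4 n4]] := pselect (large_tsum f (e / 4) bc ca ab).
  exists bc, ca, ab; split => //; last first.
    have -> : bc - a = (c - a) / 2 - (a - b) / 2 by rewrite /bc; field.
    by rewrite (le_trans (cmodB _ _))// !cmod_half; lra.
  split; split => //.
  - by apply: (hh' _ _ _ hab); rewrite /ca /bc; field.
  - by apply: (hh' _ _ _ hbc); rewrite /ab /ca; field.
  - by apply: (hh' _ _ _ hca); rewrite /ab /bc; field.
(* The successor pays for the level of subdivision that [tsumS] consumes. *)
have [[//|n] Nn] := bd (maxn (maxn N1 N2) (maxn N3 N4)).+1.
move: Nn; rewrite ltnS !geq_max => /andP[/andP[h1 h2] /andP[h3 h4]].
rewrite tsumS -/ab -/bc -/ca => he; exfalso.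
have := n1 _ h1; have := n2 _ h2; have := n3 _ h3; have := n4 _ h4.
have := cmodD (tsum f n a ab ca + tsum f n ab b bc + tsum f n ca bc c) (tsum f n bc ca ab).
have := cmodD (tsum f n a ab ca + tsum f n ab b bc) (tsum f n ca bc c).
have := cmodD (tsum f n a ab ca) (tsum f n ab b bc).
by lra.
Qed.

Lemma small_pow2 (c d : R) : 0 < d -> exists j, c / 2 ^+ j < d.
Proof.
move=> d0; have [n cn] : exists n : nat, c / d < n%:R.
  by exists (Num.bound `|c / d|); rewrite (le_lt_trans (ler_norm _))// archi_boundP.
exists n; rewrite ltr_pdivrMr ?exprn_gt0// mulrC -ltr_pdivrMr//.
by rewrite (lt_trans cn)// -natrX ltr_nat ltn_expl.
Qed.

Lemma tsum_to0 f (r : R) : (forall z, cmod z < r -> exists a, cder f z a) ->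
  forall a b c, cmod a < r -> cmod b < r -> cmod c < r ->
  forall e, 0 < e -> exists N, forall n, (N <= n)%N -> cmod (tsum f n a b c) <= e.
Proof.
move=> df a0 b0 c0 ha0 hb0 hc0 e e0; apply: not_large_tsum => bad0.
have [U [UU Uoo]] := free_ultrafilter.
(* A closed disc strictly inside the domain: the limit point of the triangles stays in it, so [f] is
   differentiable there. *)
pose rho := Num.max (cmod a0) (Num.max (cmod b0) (cmod c0)).
have rhor : rho < r by rewrite /rho !gt_max ha0 hb0 hc0.
pose D : set R[i] := [set w | cmod (w - 0) <= rho].
have mD : midconvex D by exact: midconvex_ball.
pose d := Num.max (cmod (a0 - b0)) (Num.max (cmod (b0 - c0)) (cmod (c0 - a0))).
have d0 : 0 <= d by rewrite /d le_max cmod_ge0.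
have tri0 : small_triangle D d a0 b0 c0.
  by rewrite /small_triangle /D /rho /d /=; split; split; rewrite ?subr0 !le_max lexx ?orbT.
pose T := (R[i] * R[i] * R[i])%type.
pose P (j : nat) (t : T) := small_triangle D (d / 2 ^+ j) t.1.1 t.1.2 t.2 /\
  large_tsum f (e / 4 ^+ j) t.1.1 t.1.2 t.2.
pose Q (j : nat) (t t' : T) := P j t -> P j.+1 t' /\ cmod (t'.1.1 - t.1.1) <= d / 2 ^+ j.
have [nx nxP] : exists nx : nat -> T -> T, forall j t, Q j t (nx j t).
  have := @choice (nat * T) T (fun x => Q x.1 x.2) _.
  case=> [[j t]|g gP]; last by exists (fun j t => g (j, t)) => j t; exact: (gP (j, t)).
  have [[t1 t2]|nP] := pselect (P j t); last by exists t.
  have [a' [b' [c' [h1 h2 h3]]]] := large_tsum_bisect mD t1 t2.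
  exists (a', b', c') => /= _; split => //; split => /=.
    by rewrite exprSr invfM mulrA.
  by rewrite exprSr invfM mulrA.
pose s := fix s j := if j is j'.+1 then nx j' (s j') else (a0, b0, c0).
have sP j : P j (s j).
  elim: j => [|j IH]; first by split => /=; rewrite expr0 divr1.
  by have [] := nxP j (s j) IH.
pose x j := (s j).1.1.
have xS j : cmod (x j.+1 - x j) <= d / 2 ^+ j by have [] := nxP j (s j) (sP j).
(* The partial geometric sum is kept exact, with its subtracted tail, so that the induction
   closes. *)
have xD i j : cmod (x (j + i)%N - x j) <= 2 * (d / 2 ^+ j) - 2 * (d / 2 ^+ (j + i)).
  elim: i => [|i IH]; first by rewrite addn0 !subrr cmod0.
  have := cmod_tri (x (j + i)%N) (x (j + i).+1) (x j); have := xS (j + i)%N.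
  have -> : d / 2 ^+ (j + i.+1) = d / 2 ^+ (j + i) / 2.
    by rewrite addnS exprSr invfM mulrA.
  by rewrite addnS; lra.
have xrho j : cmod (x j) <= rho by have [[[+ _ _] _] _] := sP j; rewrite /D /= subr0.
have [p xp] := ulim_ex UU xrho.
have prho : cmod p <= rho.
  rewrite -(subr0 p); apply: (ulim_le UU xp).
  by apply: (filterS _ (U_ge Uoo 0)) => n /= _; rewrite subr0.
have px j : cmod (p - x j) <= 2 * (d / 2 ^+ j).
  apply: (ulim_le UU xp); apply: (filterS _ (U_ge Uoo j)) => n /= jn.
  rewrite -(subnKC jn) (le_trans (xD _ _))// gerBl mulr_ge0//.
  by rewrite divr_ge0// exprn_ge0.
have [al dp] := df p (le_lt_trans prho rhor).
(* The [j]-th triangle has sides at most [q] and lies within [3 * q] of [p]. Its three sides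
   contribute [3 * (eta * (3 * q) * q)], hence the 9; adding 1 covers a degenerate triangle with
   [d = 0]. *)
pose eta := e / (9 * d ^+ 2 + 1).
have den0 : 0 < 9 * d ^+ 2 + 1 by have := sqr_ge0 d; lra.
have eta0 : 0 < eta by rewrite divr_gt0.
have [del del0 hdel] := dp _ eta0.
have [j hj] := small_pow2 (3 * d) del0.
pose q := d / 2 ^+ j.
have q0 : 0 <= q by rewrite divr_ge0// exprn_ge0.
have hq : 3 * q < del by rewrite /q mulrA.
pose D' : set R[i] := [set w | cmod (w - p) <= 3 * q].
have mD' : midconvex D' by exact: midconvex_ball.
have fD' w : D' w -> cmod (f w - ((f p - al * p) + al * w)) <= eta * (3 * q).
  move=> /= wp; have := hdel (w - p) (le_lt_trans wp hq).
  rewrite (addrC p) subrK.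
  have -> : f w - f p - al * (w - p) = f w - ((f p - al * p) + al * w) by ring.
  by move=> /le_trans; apply; rewrite ler_wpM2l// ltW.
have [[[Da Db Dc] [hab hbc hca]] bj] := sP j.
have hpa : cmod ((s j).1.1 - p) <= 2 * q by rewrite cmodBC; exact: px.
rewrite -/q in hab hbc hca.
have D'a : D' (s j).1.1 by rewrite /D' /=; lra.
have D'b : D' (s j).1.2.
  rewrite /D' /=; have := cmod_tri (s j).1.1 (s j).1.2 p; rewrite (cmodBC (s j).1.2 (s j).1.1); lra.
have D'c : D' (s j).2.
  by rewrite /D' /=; have := cmod_tri (s j).1.1 (s j).2 p; lra.
have [n _] := bj 0%N; apply/negP; rewrite -leNgt /tsum.
have M1 := msum_affine mD' fD' n D'a D'b.
have M2 := msum_affine mD' fD' n D'b D'c.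
have M3 := msum_affine mD' fD' n D'c D'a.
move: D'a D'b D'c hab hbc hca hpa M1 M2 M3 {bj Da Db Dc}.
move: (s j).1.1 (s j).1.2 (s j).2 => a b c _ _ _ hab hbc hca _ M1 M2 M3.

set E1 := (X in cmod (_ - X) <= _) in M1; set E2 := (X in cmod (_ - X) <= _) in M2.
set E3 := (X in cmod (_ - X) <= _) in M3.
have -> : msum f n a b + msum f n b c + msum f n c a =
  (msum f n a b - E1) + (msum f n b c - E2) + (msum f n c a - E3).
  by rewrite /E1 /E2 /E3; ring.
rewrite cmodBC in hab; rewrite cmodBC in hbc; rewrite cmodBC in hca.
have B0 : 0 <= eta * (3 * q) by apply: mulr_ge0; [exact: ltW|lra].
have M1' := le_trans M1 (ler_wpM2l B0 hab).
have M2' := le_trans M2 (ler_wpM2l B0 hbc).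
have M3' := le_trans M3 (ler_wpM2l B0 hca).
have h12 := cmodD (msum f n a b - E1) (msum f n b c - E2).
have h123 := cmodD (msum f n a b - E1 + (msum f n b c - E2)) (msum f n c a - E3).
have goal : eta * (9 * q ^+ 2) <= e / 4 ^+ j.
  have -> : (4 : R) ^+ j = (2 ^+ j) ^+ 2 by rewrite -exprM mulnC exprM; congr (_ ^+ _); ring.
  have -> : eta * (9 * q ^+ 2) = (e * (9 * d ^+ 2) / (9 * d ^+ 2 + 1)) / (2 ^+ j) ^+ 2.
    by rewrite /q expr_div_n /eta; ring.
  rewrite ler_wpM2r ?invr_ge0 ?sqr_ge0// ler_pdivrMr// ler_wpM2l ?ltW//.
  by have := sqr_ge0 d; lra.
rewrite (le_trans h123)// (le_trans _ goal)//.
have -> : eta * (9 * q ^+ 2) = eta * (3 * q) * q + eta * (3 * q) * q + eta * (3 * q) * q.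
  by ring.
by rewrite lerD// (le_trans h12)// lerD.
Qed.

(** [F z] is the ultralimit of the midpoint sums from 0 to [z]. By [tsum_to0], [F (z + h) - F z] is
    close to a midpoint sum over the segment from [z] to [z + h], to which [msum_affine] applies.
    Leaving the affine comparison free lets one estimate yield bounds of orders zero, one and
    two. *)
Lemma goursat f (r M : R) : 0 < r -> (forall z, cmod z < r -> exists a, cder f z a) ->
  (forall z, cmod z < r -> cmod (f z) <= M) ->
  exists F, forall z h al be B, cmod z < r -> cmod (z + h) < r ->
    (forall w, cmod w < r -> cmod (w - z) <= cmod h ->
      cmod (f w - (al + be * (w - z))) <= B) ->
    cmod (F (z + h) - F z - (al * h + be * h ^+ 2 / 2)) <= B * cmod h.
Proof.
move=> r0 df fM.
have [U [UU Uoo]] := free_ultrafilter.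
pose D : set R[i] := [set w | cmod w < r].
have mD : midconvex D.
  by move=> u v hu hv; rewrite /D /= cmod_half; have := cmodD u v; rewrite /D /= in hu hv; lra.
have D0 : D 0 by rewrite /D /mkset cmod0.
have FP z : exists l, cmod z < r -> ulim U (fun n => msum f n 0 z) l.
  have [zr|_] := boolP (cmod z < r); last by exists 0.
  have h n : cmod (msum f n 0 z) <= M * cmod z.
    have := @msum_affine f D 0 0 M mD _ n 0 z D0 zr.
    rewrite !(mul0r, addr0, subr0); apply => w Dw.
    by rewrite mul0r addr0 subr0; exact: fM.
  by have [l hl] := ulim_ex UU h; exists l.
have [F FE] := choice FP.
exists F => z h al be B zr zhr hB.
apply: le_eps_le => e e0; have e3 : 0 < e / 3 by lra.
have [N hN] := tsum_to0 df D0 zr zhr e3.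
have [n /= [[h1 h2] h3]] := filter_ex
   (filterI (filterI (FE z zr _ e3) (FE (z + h) zhr _ e3)) (U_ge Uoo N)).
have {}hN := hN n h3.
pose D' : set R[i] := [set w | D w /\ cmod (w - z) <= cmod h].
have mD' : midconvex D'.
  by move=> u v [Du hu] [Dv hv]; split; [exact: mD|exact: midconvex_ball].
have D'z : D' z by split => //; rewrite subrr cmod0 cmod_ge0.
have D'h : D' (z + h) by split => //; rewrite addrC addKr.
have h4 := @msum_affine f D' (al - be * z) be B mD' _ n z (z + h) D'z D'h.
have {}h4 : cmod (msum f n z (z + h) - (al * h + be * h ^+ 2 / 2)) <= B * cmod h.
  have e1 : z + h - z = h by ring.
  rewrite e1 in h4.
  have e2 : (al - be * z) * h + be * ((z + h) ^+ 2 - z ^+ 2) / 2 =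
         al * h + be * h ^+ 2 / 2 by field.
  rewrite e2 in h4.
  apply: h4 => w [Dw hw]; have := hB w Dw hw.
  by congr (cmod _ <= _); ring.
move: hN h1 h2 h4; rewrite /tsum (msumC f n 0 (z + h)).
set s1 := msum f n 0 z; set s2 := msum f n z _; set s3 := msum f n 0 _.
move=> hN h1 h2 h4.
have -> : F (z + h) - F z - (al * h + be * h ^+ 2 / 2) =
  (s2 - (al * h + be * h ^+ 2 / 2)) + (s1 - F z) - (s3 - F (z + h)) - (s1 + s2 - s3) by ring.
have := cmodB (s2 - (al * h + be * h ^+ 2 / 2) + (s1 - F z) - (s3 - F (z + h))) (s1 + s2 - s3).
have := cmodB (s2 - (al * h + be * h ^+ 2 / 2) + (s1 - F z)) (s3 - F (z + h)).
have := cmodD (s2 - (al * h + be * h ^+ 2 / 2)) (s1 - F z).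
lra.
Qed.

End Goursat.

(** * The maximum principle *)

Section Taylor.
Variable R : realType.
Implicit Types (a b c z w h : R[i]) (f g F : R[i] -> R[i]).

Definition ccont f z := forall e : R, 0 < e -> exists2 d : R, 0 < d &
  forall h, cmod h < d -> cmod (f (z + h) - f z) <= e.

(** Here [b] is half of a second derivative. The expansion is pointwise, with no continuity of its
    coefficients in [z]. *)
Definition taylor2 F z a b := forall e : R, 0 < e -> exists2 d : R, 0 < d &
  forall h, cmod h < d -> cmod (F (z + h) - F z - a * h - b * h ^+ 2) <= e * cmod h ^+ 2.

Lemma cder_ccont f z a : cder f z a -> ccont f z.
Proof.
move=> df e e0; have [d d0 hd] := df _ ltr01.
have a1 : 0 < cmod a + 1 by have := cmod_ge0 a; lra.
exists (Num.min d (e / (cmod a + 1))); first by rewrite lt_min d0 divr_gt0.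
move=> h; rewrite lt_min ltr_pdivlMr// => /andP[h1 h2].
have -> : f (z + h) - f z = (f (z + h) - f z - a * h) + a * h by ring.
have := hd h h1; have := cmodD (f (z + h) - f z - a * h) (a * h); rewrite cmodM; lra.
Qed.

Lemma taylor2_cder F z a b : taylor2 F z a b -> cder F z a.
Proof.
move=> TF e e0; have [d d0 hd] := TF _ ltr01.
have a1 : 0 < cmod b + 1 by have := cmod_ge0 b; lra.
exists (Num.min d (e / (cmod b + 1))); first by rewrite lt_min d0 divr_gt0.
move=> h; rewrite lt_min ltr_pdivlMr// => /andP[h1 h2].
have := hd h h1; have := cmodD (F (z + h) - F z - a * h - b * h ^+ 2) (b * h ^+ 2).
rewrite subrK cmodM cmodX => H1 H2; rewrite (le_trans H1)//.
have := ler_wpM2r (cmod_ge0 h) (ltW h2); have := cmod_ge0 h; nra.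
Qed.

Lemma cder_ext f g z a : (exists2 d : R, 0 < d & forall h, cmod h < d -> f (z + h) = g (z + h)) ->
  cder f z a -> cder g z a.
Proof.
move=> [d d0 fg] df e e0; have [d' d'0 hd] := df e e0.
exists (Num.min d d'); first by rewrite lt_min d0.
move=> h; rewrite lt_min => /andP[h1 h2]; rewrite -fg//.
by have := fg 0; rewrite addr0 => <-; [exact: hd|rewrite cmod0].
Qed.

Lemma taylor2_ext f g z a b :
  (exists2 d : R, 0 < d & forall h, cmod h < d -> f (z + h) = g (z + h)) ->
  taylor2 f z a b -> taylor2 g z a b.
Proof.
move=> [d d0 fg] df e e0; have [d' d'0 hd] := df e e0.
exists (Num.min d d'); first by rewrite lt_min d0.
move=> h; rewrite lt_min => /andP[h1 h2]; rewrite -fg//.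
by have := fg 0; rewrite addr0 => <-; [exact: hd|rewrite cmod0].
Qed.

Lemma cderB f g z a b : cder f z a -> cder g z b -> cder (fun w => f w - g w) z (a - b).
Proof.
move=> df dg e e0; have e2 : 0 < e / 2 by lra.
have [d1 d10 h1] := df _ e2; have [d2 d20 h2] := dg _ e2.
exists (Num.min d1 d2); first by rewrite lt_min d10.
move=> h; rewrite lt_min => /andP[/h1 {}h1 /h2 {}h2].
have -> : f (z + h) - g (z + h) - (f z - g z) - (a - b) * h =
  (f (z + h) - f z - a * h) - (g (z + h) - g z - b * h) by ring.
by rewrite (le_trans (cmodB _ _))//; lra.
Qed.

Lemma taylor2_diffq F z h a b a' b' c : taylor2 F z a b -> taylor2 F (z + h) a' b' ->
  taylor2 (fun w => (F (w + h) - F w) * c) z ((a' - a) * c) ((b' - b) * c).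
Proof.
move=> T1 T2 e e0; have c1 : 0 < 2 * (cmod c + 1) by have := cmod_ge0 c; lra.
have e2 : 0 < e / (2 * (cmod c + 1)) by rewrite divr_gt0.
have [d1 d10 h1] := T1 _ e2; have [d2 d20 h2] := T2 _ e2.
exists (Num.min d1 d2); first by rewrite lt_min d10.
move=> k; rewrite lt_min => /andP[/h1 {}h1 /h2 {}h2].
have -> : (F (z + k + h) - F (z + k)) * c - (F (z + h) - F z) * c - (a' - a) * c * k -
  (b' - b) * c * k ^+ 2 = ((F (z + h + k) - F (z + h) - a' * k - b' * k ^+ 2) -
   (F (z + k) - F z - a * k - b * k ^+ 2)) * c by rewrite (addrAC z h k); ring.
rewrite cmodM; have := cmodB (F (z + h + k) - F (z + h) - a' * k - b' * k ^+ 2)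
   (F (z + k) - F z - a * k - b * k ^+ 2).
set X := cmod (_ - _); set E := e / _ in h1 h2 => hX.
have eE : e = E * (2 * (cmod c + 1)) by rewrite /E divfK// gt_eqF.
have E0 : 0 < E by exact: e2.
have hX2 : X <= 2 * (E * cmod k ^+ 2) by rewrite (le_trans hX)//; lra.
rewrite (le_trans (ler_wpM2r (cmod_ge0 c) hX2))//.
have : 0 <= E * cmod k ^+ 2 by rewrite mulr_ge0 ?exprn_ge0 ?cmod_ge0// ltW.
by rewrite eE; nra.
Qed.

Lemma taylor2_quot F z w a b c : taylor2 F z a b -> z != w ->
  exists a' b', taylor2 (fun x => (F x - c) / (x - w)) z a' b'.
Proof.
move=> TF zw; pose u := z - w; have u0 : u != 0 by rewrite subr_eq0.
have cu : 0 < cmod u by rewrite cmod_gt0.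
(* Division of the expansion of [F - c] by [u + h]: these coefficients match orders 0, 1 and 2 and
   leave only the remainder [q2 * h ^+ 3]. *)
pose q0 := (F z - c) / u; pose q1 := (a - q0) / u; pose q2 := (b - q1) / u.
exists q1, q2 => e e0.
have e4 : 0 < e * cmod u / 4 by rewrite divr_gt0 ?mulr_gt0.
have [d d0 hd] := TF _ e4.
have q21 : 0 < 4 * (cmod q2 + 1) by have := cmod_ge0 q2; lra.
exists (Num.min d (Num.min (cmod u / 2) (e * cmod u / (4 * (cmod q2 + 1))))).
  rewrite !lt_min d0 /=; apply/andP; split; first by rewrite divr_gt0.
  by apply: divr_gt0 => //; exact: mulr_gt0.
move=> h; rewrite !lt_min => /and3P[/hd h1 h2 h3].
have cuh : cmod u / 2 <= cmod (u + h).
  by have := cmodB (u + h) h; rewrite addrK; lra.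
have uh0 : u + h != 0 by rewrite -cmod_gt0 (lt_le_trans _ cuh)// divr_gt0.
have -> : (F (z + h) - c) / (z + h - w) - (F z - c) / (z - w) - q1 * h - q2 * h ^+ 2 =
  ((F (z + h) - F z - a * h - b * h ^+ 2) - q2 * h ^+ 3) / (u + h).
  have -> : z + h - w = u + h by rewrite /u; ring.
  by rewrite -/u /q2 /q1 /q0; field; rewrite uh0 u0.
rewrite cmodf ler_pdivrMr; last by rewrite cmod_gt0.
rewrite (le_trans (cmodB _ _))// cmodM cmodX.
have H1 : e * cmod h ^+ 2 * (cmod u / 2) <= e * cmod h ^+ 2 * cmod (u + h).
  by rewrite ler_wpM2l// mulr_ge0 ?exprn_ge0 ?cmod_ge0// ltW.
rewrite (le_trans _ H1)//.
move: h3; rewrite ltr_pdivlMr// => h3.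
have hh := cmod_ge0 h; have hq := cmod_ge0 q2.
have : cmod q2 * cmod h ^+ 3 <= e * cmod u / 4 * cmod h ^+ 2.
  rewrite exprS mulrA ler_wpM2r ?exprn_ge0//; nra.
by lra.
Qed.

End Taylor.

Section MaximumPrinciple.
Variable R : realType.
Implicit Types (a b c z w h : R[i]) (f g F Q : R[i] -> R[i]) (t s m K M : R).

(** The ultralimit of a maximizing sequence stays in the closed disc and realizes the supremum by
    continuity. *)
Lemma disc_max (u : R[i] -> R) s K : 0 < s -> (forall z, cmod z <= s -> u z <= K) ->
  (forall z, cmod z <= s -> forall e, 0 < e -> exists2 d, 0 < d &
     forall h, cmod h < d -> `|u (z + h) - u z| <= e) ->
  exists2 z0, cmod z0 <= s & forall z, cmod z <= s -> u z <= u z0.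
Proof.
move=> s0 uK uc; have [U [UU Uoo]] := free_ultrafilter.
pose E := [set u z | z in [set z | cmod z <= s]].
have hsE : has_sup E.
  split; first by exists (u 0), 0; rewrite //= cmod0 ltW.
  by exists K => _ [z /= zs <-]; exact: uK.
have /choice[x hx] : forall n : nat, exists y, cmod y <= s /\ sup E - n.+1%:R^-1 < u y.
  move=> n.
  have n0 : (0 : R) < n.+1%:R^-1 by rewrite invr_gt0.
  by have [_ [z zs <-] hz] := sup_adherent n0 hsE; exists z.
have [z0 xz0] := ulim_ex UU (fun n => (hx n).1).
have z0s : cmod z0 <= s.
  rewrite -(subr0 z0); apply: (ulim_le UU xz0).
  by apply: (filterS _ (U_ge Uoo 0)) => n _; rewrite /mkset subr0 (hx n).1.
exists z0 => // z zs; apply: le_eps_le => e e0.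
have zE : u z <= sup E by apply: sup_upper_bound => //; exists z.
have e2 : 0 < e / 2 by lra.
have [d d0 hd] := uc z0 z0s _ e2.
have [N hN] : exists N : nat, N.+1%:R^-1 < e / 2.
  exists (Num.bound (2 / e)); rewrite invf_plt ?posrE// ?ltr0Sn//.
  rewrite invf_div (@lt_trans _ _ (Num.bound (2 / e))%:R) ?ltr_nat//.
  by rewrite archi_boundP// divr_ge0// ltW.
have [n /= [h1 h2]] := filter_ex (filterI (xz0 d d0) (U_ge Uoo N)).
have := hd _ h1; rewrite (addrC z0) subrK => h3.
have h4 := (hx n).2; have h5 : n.+1%:R^-1 <= N.+1%:R^-1 :> R.
  by rewrite lef_pV2 ?posrE// ler_nat.
move: hN h4 h5; set i1 := n.+1%:R^-1; set i2 := N.+1%:R^-1 => hN h4 h5.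
have h6 := ler_norm (u (x n) - u z0); clear -h3 h4 h5 h6 hN zE; lra.
Qed.

Lemma sqr_lower (x p r : R) : 0 <= x -> 0 <= p -> 0 <= r -> p - r <= x ->
  p ^+ 2 - 2 * (p * r) <= x ^+ 2.
Proof.
move=> x0 p0 r0 h; have [rp|pr] := leP r p.
  have : (p - r) ^+ 2 <= x ^+ 2 by rewrite lerXn2r ?nnegrE ?subr_ge0.
  have := sqr_ge0 r; nra.
by have := sqr_ge0 x; nra.
Qed.

Definition bumpsq Q e c z : R := cmod (Q z) ^+ 2 + e * cmod (z - c) ^+ 2.

Lemma bumpsq_cont Q e c z : ccont Q z -> forall eta : R, 0 < eta -> exists2 d : R, 0 < d &
  forall h, cmod h < d -> `|bumpsq Q e c (z + h) - bumpsq Q e c z| <= eta.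
Proof.
have sq (x y : R[i]) (k : R) : cmod (x - y) <= k -> k <= 1 ->
    `|cmod x ^+ 2 - cmod y ^+ 2| <= (2 * cmod y + 1) * k.
  move=> hk k1; have h1 := cmod_sub x y; have h2 := cmod_sub y x.
  rewrite (cmodBC y x) in h2; rewrite subr_sqr normrM mulrC.
  have hx := cmod_ge0 x; have hy := cmod_ge0 y.
  have hn : `|cmod x - cmod y| <= k by rewrite ler_norml; apply/andP; split; lra.
  have hs : `|cmod x + cmod y| <= 2 * cmod y + 1 by rewrite ger0_norm ?addr_ge0//; lra.
  by apply: ler_pM; rewrite ?normr_ge0.
move=> Qc eta eta0.
pose A := 2 * cmod (Q z) + 1; pose B := 2 * cmod (z - c) + 1.
have A0 : 0 < A by rewrite /A; have := cmod_ge0 (Q z); lra.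
have B0 : 0 < B by rewrite /B; have := cmod_ge0 (z - c); lra.
have C0 : 0 < 2 * (`|e| + 1) * B by rewrite !mulr_gt0//; have := normr_ge0 e; lra.
pose k1 := Num.min 1 (eta / (2 * A)); pose k2 := Num.min 1 (eta / (2 * (`|e| + 1) * B)).
have k10 : 0 < k1 by rewrite /k1 lt_min ltr01 divr_gt0 ?mulr_gt0.
have k20 : 0 < k2 by rewrite /k2 lt_min ltr01 divr_gt0.
have [d d0 hd] := Qc _ k10.
exists (Num.min d k2); first by rewrite lt_min d0.
move=> h; rewrite lt_min => /andP[/hd h1 /ltW h2].
have hk1 : A * k1 <= eta / 2.
  have : k1 <= eta / (2 * A) by rewrite /k1 ge_min lexx orbT.
  rewrite ler_pdivlMr ?mulr_gt0//; lra.
have hk2 : `|e| * (B * k2) <= eta / 2.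
  have : k2 <= eta / (2 * (`|e| + 1) * B) by rewrite /k2 ge_min lexx orbT.
  rewrite ler_pdivlMr//; have := normr_ge0 e.
  have : 0 <= B * k2 by rewrite mulr_ge0// ltW.
  nra.
have H1 := sq _ _ _ h1 (_ : k1 <= 1); rewrite ge_min lexx in H1; have {}H1 := H1 isT.
have e2 : z + h - c - (z - c) = h by ring.
have H2 := sq (z + h - c) (z - c) k2; rewrite e2 ge_min lexx in H2.
have {}H2 := H2 h2 isT.
rewrite /bumpsq.
have -> : cmod (Q (z + h)) ^+ 2 + e * cmod (z + h - c) ^+ 2 -
    (cmod (Q z) ^+ 2 + e * cmod (z - c) ^+ 2) =
  (cmod (Q (z + h)) ^+ 2 - cmod (Q z) ^+ 2) +
    e * (cmod (z + h - c) ^+ 2 - cmod (z - c) ^+ 2) by ring.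
rewrite (le_trans (ler_normD _ _))// normrM.
have := ler_wpM2l (normr_ge0 e) H2; rewrite -/A -/B in H1 *; lra.
Qed.

(* The sum over the four points [z + i^k t] kills the linear and quadratic
   harmonic terms of [|Q|^2], so that only [e |z - c|^2] contributes. *)
Lemma bumpsq_taylor2_nmax Q e c z a b : 0 < e -> taylor2 Q z a b ->
  ~ (exists2 d : R, 0 < d & forall h, cmod h < d -> bumpsq Q e c (z + h) <= bumpsq Q e c z).
Proof.
move=> e0 TQ [d d0 hmax].
pose L := cmod (Q z) + cmod a + cmod b + 1.
have L0 : 0 < L by rewrite /L; have := cmod_ge0 (Q z); have := cmod_ge0 a; have := cmod_ge0 b; lra.
(* As [L] bounds the Taylor polynomial [P], the remainder lowers [|Q|^2] by at most
   [e * t ^+ 2 / 2], half of the average gain [e * t ^+ 2] of the bump over the four points. *)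
have eL : 0 < e / (4 * L) by rewrite divr_gt0// mulr_gt0.
have [d1 d10 hd1] := TQ _ eL.
pose t := Num.min (Num.min d d1) 1 / 2.
have m0 : 0 < Num.min (Num.min d d1) 1 by rewrite !lt_min d0 d10 ltr01.
have t0 : 0 < t by rewrite /t divr_gt0.
have td : t < d.
  have : Num.min (Num.min d d1) 1 <= d by rewrite !ge_min lexx.
  rewrite /t; lra.
have td1 : t < d1.
  have : Num.min (Num.min d d1) 1 <= d1 by rewrite !ge_min lexx orbT.
  rewrite /t; lra.
have t1 : t <= 1.
  have : Num.min (Num.min d d1) 1 <= 1 by rewrite !ge_min lexx orbT.
  rewrite /t; lra.
pose P h := Q z + a * h + b * h ^+ 2.
have key h : cmod h = t ->
    cmod (P h) ^+ 2 + e * cmod (z + h - c) ^+ 2 <= bumpsq Q e c z + e * t ^+ 2 / 2.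
  move=> ht; have hd := hd1 h; rewrite ht in hd; have {}hd := hd td1.
  have hm := hmax h; rewrite ht in hm; have {}hm := hm td.
  have PL : cmod (P h) <= L.
    rewrite /P (le_trans (cmodD _ _))// cmodM cmodX ht.
    have := cmodD (Q z) (a * h); rewrite cmodM ht => H.
    have Ha := cmod_ge0 a; have Hb := cmod_ge0 b.
    have : t ^+ 2 <= 1 by rewrite expr_le1// ltW.
    rewrite /L; nra.
  pose r := cmod (Q (z + h) - P h).
  have hr : r <= e / (4 * L) * t ^+ 2.
    by move: hd; congr (_ <= _); congr cmod; rewrite /P; ring.
  have r0 : 0 <= r by exact: cmod_ge0.
  have lowP : cmod (P h) - r <= cmod (Q (z + h)).
    have := cmod_sub (P h) (Q (z + h)); rewrite (cmodBC (P h)) -/r; lra.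
  have := sqr_lower (cmod_ge0 (Q (z + h))) (cmod_ge0 (P h)) r0 lowP.
  have : cmod (P h) * r <= e * t ^+ 2 / 4.
    have -> : e * t ^+ 2 / 4 = L * (e / (4 * L) * t ^+ 2).
      by field; rewrite gt_eqF.
    by rewrite ler_pM// cmod_ge0.
  rewrite /bumpsq in hm *; lra.
have ct : cmod t%:C = t by rewrite cmod_real gtr0_norm.
have k1 := key t%:C ct.
have k2 := key (- t%:C) (etrans (cmodN _) ct).
have cti : cmod ('i * t%:C) = t by rewrite cmodM cmod_i mul1r.
have k3 := key ('i * t%:C) cti.
have k4 := key (- ('i * t%:C)) (etrans (cmodN _) cti).
have t2 : 0 < e * t ^+ 2 by rewrite mulr_gt0// exprn_gt0.
move: k1 k2 k3 k4; rewrite /bumpsq /P !cmod_sqr.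
have := sqr_ge0 (complex.Re a * t); have := sqr_ge0 (complex.Im a * t).
have := sqr_ge0 (complex.Re b * t ^+ 2); have := sqr_ge0 (complex.Im b * t ^+ 2).
case: (Q z) => q1 q2; case: a {TQ L L0 eL hd1 key P} => a1 a2; case: b => b1 b2.
case: z {hmax} => z1 z2; case: c => c1 c2.
rewrite /= => A1 A2 B1 B2 k1 k2 k3 k4.
have : e * t ^+ 2 * 4 <= e * t ^+ 2 / 2 * 4.
  nra.
lra.
Qed.

(** With [q = Q z] and [u = z - c], [g] is the derivative of [bumpsq] with respect to [z], its
    conjugate held fixed. The increment [h] points along steepest ascent, so the first order term is
    positive unless [g] vanishes. *)
Lemma bump_identity (q b u : R[i]) (e t : R) :
  let g := conjc q * b + e%:C * conjc u in let h := t%:C * conjc g in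
  cmod (q + b * h) ^+ 2 + e * cmod (u + h) ^+ 2 =
   cmod q ^+ 2 + e * cmod u ^+ 2 + 2 * (t * cmod g ^+ 2) + cmod (b * h) ^+ 2 + e * cmod h ^+ 2.
Proof.
move=> g h; rewrite /h /g !cmod_sqr {g h}; case: q b u => q1 q2 [b1 b2] [u1 u2] /=.
ring.
Qed.

(* At the point where only a first derivative is available, a maximum of
   [bumpsq] forces this equation, which fails for [c = 0] or for [c = 1]. *)
Lemma bumpsq_cder_max Q e c z b : 0 < e -> cder Q z b ->
  (exists2 d : R, 0 < d & forall h, cmod h < d -> bumpsq Q e c (z + h) <= bumpsq Q e c z) ->
  conjc (Q z) * b + e%:C * conjc (z - c) = 0.
Proof.
move=> e0 dQ [d d0 hmax]; set g := (_ + _).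
apply/eqP; rewrite -cmod_le0; apply/negP => /negP; rewrite -ltNge => g0.
pose L := cmod (Q z) + cmod b + 1.
have L0 : 0 < L by rewrite /L; have := cmod_ge0 (Q z); have := cmod_ge0 b; lra.
have eL : 0 < cmod g / (2 * L) by rewrite divr_gt0// mulr_gt0.
have [d1 d10 hd1] := dQ _ eL.
pose t := Num.min (Num.min d d1) 1 / (2 * cmod g).
have m0 : 0 < Num.min (Num.min d d1) 1 by rewrite !lt_min d0 d10 ltr01.
have t0 : 0 < t by rewrite /t divr_gt0// mulr_gt0.
pose h := t%:C * conjc g.
have cgJ : cmod (conjc g) = cmod g by apply: complexI; rewrite -!normE normcJ.
have ch : cmod h = Num.min (Num.min d d1) 1 / 2.
  by rewrite cmodM cmod_real gtr0_norm// cgJ /t; field; rewrite gt_eqF.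
have hd : cmod h < d.
  have : Num.min (Num.min d d1) 1 <= d by rewrite !ge_min lexx.
  rewrite ch; lra.
have h1 : cmod h <= 1.
  have : Num.min (Num.min d d1) 1 <= 1 by rewrite !ge_min lexx orbT.
  rewrite ch; lra.
have hd1' : cmod h < d1.
  have : Num.min (Num.min d d1) 1 <= d1 by rewrite !ge_min lexx orbT.
  rewrite ch; lra.
have hm := hmax h hd; have hq := hd1 h hd1'.
pose P := Q z + b * h.
have PL : cmod P < L.
  rewrite /P (le_lt_trans (cmodD _ _))// cmodM.
  by have := ler_wpM2l (cmod_ge0 b) h1; rewrite /L; lra.
pose r := cmod (Q (z + h) - P).
have hr : r <= cmod g / (2 * L) * cmod h.
  by move: hq; congr (_ <= _); congr cmod; rewrite /P; ring.
have r0 : 0 <= r by exact: cmod_ge0.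
have lowP : cmod P - r <= cmod (Q (z + h)).
  have := cmod_sub P (Q (z + h)); rewrite (cmodBC P) -/r; lra.
have low := sqr_lower (cmod_ge0 (Q (z + h))) (cmod_ge0 P) r0 lowP.
have hPr : cmod P * r <= cmod g * cmod h / 2.
  have -> : cmod g * cmod h / 2 = L * (cmod g / (2 * L) * cmod h).
    by field; rewrite gt_eqF.
  by rewrite ler_pM// ?cmod_ge0// ltW.
have gh : cmod g * cmod h = t * cmod g ^+ 2.
  by rewrite /h cmodM cmod_real gtr0_norm// cgJ; ring.
have id : cmod P ^+ 2 + e * cmod (z + h - c) ^+ 2 =
   bumpsq Q e c z + 2 * (t * cmod g ^+ 2) + cmod (b * h) ^+ 2 + e * cmod h ^+ 2.
  by rewrite (addrAC z h) (bump_identity (Q z) b (z - c) e t).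
have b0 : 0 <= cmod (b * h) ^+ 2 by rewrite exprn_ge0 ?cmod_ge0.
have eh : 0 <= e * cmod h ^+ 2 by rewrite mulr_ge0 ?exprn_ge0 ?cmod_ge0// ltW.
have tg : 0 < t * cmod g ^+ 2 by rewrite mulr_gt0// exprn_gt0.
rewrite /bumpsq in hm id; rewrite gh in hPr; lra.
Qed.

(** The point [w] is where a slope has been completed by its limit. The bump [e |z - c|^2] excludes
    interior maxima, at [w] by the choice of [c], and [e] is then sent to 0. *)
Lemma max_principle Q s w K m : 0 < s ->
  (forall z, cmod z <= s -> z != w -> exists a b, taylor2 Q z a b) ->
  (exists b, cder Q w b) -> (forall z, cmod z <= s -> cmod (Q z) <= K) ->
  (forall z, cmod z = s -> cmod (Q z) <= m) ->
  forall z, cmod z <= s -> cmod (Q z) <= m.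
Proof.
move=> s0 TQ [b dQ] QK Qm z zs.
have m0 : 0 <= m.
  rewrite (le_trans (cmod_ge0 (Q s%:C)))// Qm// cmod_real gtr0_norm//.
rewrite -(@ler_pXn2r _ 2) ?nnegrE ?cmod_ge0//.
apply: le_eps_le => eps eps0.
(* On the disc [cmod (z - c) <= s + 1], because [cmod c <= 1]; the bump is therefore at most
   [eps]. *)
pose e := eps / (s + 1) ^+ 2.
have s1 : 0 < (s + 1) ^+ 2 by rewrite exprn_gt0//; lra.
have e0 : 0 < e by rewrite divr_gt0.
(* Subtracting the equations for [c = 0] and [c = 1] would leave [e = 0]. *)
have [c c1 hc] : exists2 c, cmod c <= 1 & conjc (Q w) * b + e%:C * conjc (w - c) != 0.
  have [h0|h0] := eqVneq (conjc (Q w) * b + e%:C * conjc (w - 0)) 0; last first.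
    by exists 0; rewrite ?cmod0.
  exists 1; rewrite ?cmod1//; apply/eqP => h1.
  have : e%:C = 0.
    have -> : e%:C = (conjc (Q w) * b + e%:C * conjc (w - 0)) - (conjc (Q w) * b + e%:C * conjc (w - 1)).
      have -> : conjc (w - 1) = conjc w - 1.
        by case: w {dQ h0 h1 TQ} => x y; apply/eqP; rewrite eq_complex /= oppr0 !addr0 !eqxx.
      by rewrite subr0; ring.
    by rewrite h0 h1 subr0.
  by case=> /eqP; rewrite gt_eqF.
have Qc x : cmod x <= s -> ccont Q x.
  move=> xs; have [->|xw] := eqVneq x w; first exact: cder_ccont dQ.
  by have [a' [b' T]] := TQ x xs xw; exact: cder_ccont (taylor2_cder T).
have [z0 z0s hmax] : exists2 z0, cmod z0 <= s &
    forall z, cmod z <= s -> bumpsq Q e c z <= bumpsq Q e c z0.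
  apply: (@disc_max _ _ (K ^+ 2 + e * (s + 1) ^+ 2)) => //.
    move=> x xs; rewrite /bumpsq; apply: lerD.
      by rewrite lerXn2r ?nnegrE ?cmod_ge0 ?(le_trans (cmod_ge0 _) (QK _ xs))// QK.
    apply: ler_wpM2l; first exact: ltW.
    by have := cmodB x c; have := cmod_ge0 (x - c); nra.
  by move=> x xs; exact: bumpsq_cont (Qc x xs).
have z0E : cmod z0 = s.
  apply/eqP; rewrite eq_le z0s leNgt /=; apply/negP => z0lt.
  have loc : exists2 d : R, 0 < d & forall h, cmod h < d ->
      bumpsq Q e c (z0 + h) <= bumpsq Q e c z0.
    exists (s - cmod z0); first by rewrite subr_gt0.
    by move=> h hh; apply: hmax; have := cmodD z0 h; lra.
  have [z0w|z0w] := eqVneq z0 w.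
    rewrite z0w in loc; have := bumpsq_cder_max e0 dQ loc; exact/eqP.
  by have [a' [b' T]] := TQ z0 z0s z0w; exact: (bumpsq_taylor2_nmax e0 T loc).
have h1 := hmax z zs.
have h2 : cmod (Q z0) ^+ 2 <= m ^+ 2 by rewrite lerXn2r ?nnegrE ?cmod_ge0// Qm.
have h3 : e * cmod (z0 - c) ^+ 2 <= eps.
  rewrite /e mulrAC ler_pdivrMr//; apply: ler_wpM2l; first exact: ltW.
  by have := cmodB z0 c; have := cmod_ge0 (z0 - c); nra.
have h4 : 0 <= e * cmod (z - c) ^+ 2 by rewrite mulr_ge0 ?exprn_ge0 ?cmod_ge0// ltW.
rewrite /bumpsq in h1; lra.
Qed.

End MaximumPrinciple.

(** * Cauchy estimates and removable singularities *)

Section Regularity.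
Variable R : realType.
Implicit Types (a b c z w h : R[i]) (f g F Q p : R[i] -> R[i]) (t s m K M r : R).

Lemma taylor2_slope_cder F w a b : taylor2 F w a b ->
  cder (fun z => if z == w then a else (F z - F w) / (z - w)) w b.
Proof.
move=> TF e e0; have [d d0 hd] := TF _ e0; exists d => // h /hd {}hd.
have [->|h0] := eqVneq h 0; first by rewrite addr0 eqxx mulr0 !subrr cmod0 mulr0.
have hw : (w + h == w) = false by rewrite -subr_eq0 addrC addKr (negPf h0).
rewrite hw eqxx; have -> : w + h - w = h by ring.
have -> : (F (w + h) - F w) / h - a - b * h = (F (w + h) - F w - a * h - b * h ^+ 2) / h.
  by field.
have ch : 0 < cmod h by rewrite cmod_gt0.
by rewrite cmodf ler_pdivrMr// -mulrA -expr2.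
Qed.

Lemma taylor2_slope F w a b c z : taylor2 F z a b -> z != w ->
  exists a' b', taylor2 (fun x => if x == w then c else (F x - F w) / (x - w)) z a' b'.
Proof.
move=> TF zw; have [a' [b' T]] := taylor2_quot (F w) TF zw.
exists a', b'; apply: taylor2_ext T.
exists (cmod (z - w)); first by rewrite cmod_gt0 subr_eq0.
move=> h hh; case: eqP => // zhw; exfalso.
by move: hh; rewrite -zhw opprD addNKr cmodN ltxx.
Qed.

(* The maximum principle for the slope of [F] at [w]. *)
Lemma taylor2_lipschitz F r M L : 0 < r ->
  (forall z, cmod z < r -> exists a b, taylor2 F z a b) ->
  (forall z, cmod z < r -> cmod (F z) <= M) ->
  (forall z w, cmod z < r -> cmod w < r -> cmod (F z - F w) <= L * cmod (z - w)) ->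
  forall z w, cmod z <= r / 2 -> cmod w <= r / 4 ->
  cmod (F z - F w) <= 8 * M / r * cmod (z - w).
Proof.
move=> r0 TF FM FL z w zr wr.
have [->|zw] := eqVneq z w; first by rewrite !subrr cmod0 mulr0.
have wr' : cmod w < r by lra.
have [a [b Tw]] := TF w wr'.
pose Q x := if x == w then a else (F x - F w) / (x - w).
have M0 : 0 <= M by rewrite (le_trans (cmod_ge0 (F w)))// FM.
have QL x : cmod x <= r / 2 -> x != w -> cmod (Q x) <= L.
  move=> xr xw; rewrite /Q (negPf xw) cmodf ler_pdivrMr ?FL//; first lra.
  by rewrite cmod_gt0 subr_eq0.
(* The Lipschitz bound [L] makes the slope bounded a priori. On the circle of radius [r / 2] one has
   [cmod (x - w) >= r / 4] and a numerator at most [2 * M], hence [8 * M / r]. *)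
have := @max_principle _ Q (r / 2) w (Num.max L (cmod a)) (8 * M / r).
have r2 : 0 < r / 2 by lra.
move=> /(_ r2) H; have : cmod (Q z) <= 8 * M / r.
  apply: H => //.
  - move=> x xr xw; have xr' : cmod x < r by lra.
    by have [a' [b' T]] := TF x xr'; exact: taylor2_slope T xw.
  - by exists b; exact: taylor2_slope_cder.
  - move=> x xr; rewrite le_max; have [xw|xw] := eqVneq x w.
      by rewrite /Q xw eqxx lexx orbT.
    by rewrite QL.
  - move=> x xr; have hxw : r / 4 <= cmod (x - w) by have := cmod_sub x w; lra.
    have xw : x != w by apply/eqP => e; rewrite e subrr cmod0 in hxw; lra.
    have xr' : cmod x < r by lra.
    rewrite /Q (negPf xw) cmodf ler_pdivrMr; last by rewrite cmod_gt0 subr_eq0.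
    have := cmodB (F x) (F w); have := FM x xr'; have := FM w wr'.
    have : 8 * M / r * (r / 4) <= 8 * M / r * cmod (x - w).
      by rewrite ler_wpM2l// divr_ge0 ?mulr_ge0// ltW.
    have -> : 8 * M / r * (r / 4) = 2 * M by field; rewrite gt_eqF.
    lra.
rewrite /Q (negPf zw) cmodf ler_pdivrMr//.
by rewrite cmod_gt0 subr_eq0.
Qed.

(** The three clauses are [goursat] with the affine functions [f z + a * (w - z)], [0] and [f z]. *)
Lemma goursat_primitive f r M : 0 < r -> (forall z, cmod z < r -> exists a, cder f z a) ->
  (forall z, cmod z < r -> cmod (f z) <= M) ->
  exists F, [/\ forall z, cmod z < r -> exists b, taylor2 F z (f z) b,
    forall z h, cmod z < r -> cmod (z + h) < r -> cmod (F (z + h) - F z) <= M * cmod h &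
    forall z h B, cmod z < r -> cmod (z + h) < r ->
      (forall w, cmod w < r -> cmod (w - z) <= cmod h -> cmod (f w - f z) <= B) ->
      cmod (F (z + h) - F z - f z * h) <= B * cmod h].
Proof.
move=> r0 df fM; have [F HF] := goursat r0 df fM.
exists F; split.
- move=> z zr; have [a da] := df z zr; exists (a / 2) => e e0.
  have [d d0 hd] := da e e0.
  exists (Num.min d (r - cmod z)); first by rewrite lt_min d0 subr_gt0.
  move=> h; rewrite lt_min => /andP[h1 h2].
  have zhr : cmod (z + h) < r by have := cmodD z h; lra.
  have -> : F (z + h) - F z - f z * h - a / 2 * h ^+ 2 =
            F (z + h) - F z - (f z * h + a * h ^+ 2 / 2) by ring.
  have -> : e * cmod h ^+ 2 = e * cmod h * cmod h by ring.
  apply: HF => // w _ hw.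
  have := hd (w - z) (le_lt_trans hw h1); rewrite (addrC z) subrK => H.
  rewrite opprD addrA (le_trans H)// ler_wpM2l// ltW//.
- move=> z h zr zhr; have := HF z h 0 0 M zr zhr.
  rewrite !mul0r addr0 subr0; apply => w wr _.
  by rewrite mul0r addr0 subr0 fM.
- move=> z h B zr zhr hB; have := HF z h (f z) 0 B zr zhr.
  rewrite !mul0r addr0; apply => w wr hw.
  by rewrite mul0r addr0 hB.
Qed.

(** The difference quotients [q] of a primitive are bounded by [M] and have second order expansions.
    Their Lipschitz constant from [taylor2_lipschitz] does not depend on the step [h], so it
    survives the passage from [q] to [f]. *)
Lemma cder_lipschitz f r M : 0 < r -> (forall z, cmod z < r -> exists a, cder f z a) ->
  (forall z, cmod z < r -> cmod (f z) <= M) ->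
  forall z w, cmod z <= r / 4 -> cmod w <= r / 8 ->
  cmod (f z - f w) <= 16 * M / r * cmod (z - w).
Proof.
move=> r0 df fM z w zr wr.
have [F [FT FM _]] := goursat_primitive r0 df fM.
have M0 : 0 <= M by rewrite (le_trans (cmod_ge0 (f 0)))// fM// cmod0.
have zr' : cmod z < r by lra.
have wr' : cmod w < r by lra.
apply: le_eps_le => e e0; have e2 : 0 < e / 2 by lra.
have [bz Tz] := FT z zr'; have [bw Tw] := FT w wr'.
have [d1 d10 h1] := taylor2_cder Tz e2; have [d2 d20 h2] := taylor2_cder Tw e2.
pose d := Num.min (Num.min d1 d2) r / 4.
have m0 : 0 < Num.min (Num.min d1 d2) r by rewrite !lt_min d10 d20.
have dd1 : d < d1.
  have : Num.min (Num.min d1 d2) r <= d1 by rewrite !ge_min lexx.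
  rewrite /d; lra.
have dd2 : d < d2.
  have : Num.min (Num.min d1 d2) r <= d2 by rewrite !ge_min lexx orbT.
  rewrite /d; lra.
have dr : d <= r / 4.
  have : Num.min (Num.min d1 d2) r <= r by rewrite !ge_min lexx orbT.
  rewrite /d; lra.
have d0 : 0 < d by rewrite /d divr_gt0.
pose h : R[i] := d%:C.
have ch : cmod h = d by rewrite cmod_real gtr0_norm.
have h0 : h != 0 by rewrite -cmod_gt0 ch.
pose q x := (F (x + h) - F x) * h^-1.
have sh x : cmod x < r / 2 -> cmod x < r /\ cmod (x + h) < r.
  by move=> xr; split; [|have := cmodD x h]; lra.
have qM x : cmod x < r / 2 -> cmod (q x) <= M.
  move=> /sh[x1 x2]; rewrite /q cmodf ler_pdivrMr; last by rewrite ch.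
  exact: FM.
have r2 : 0 < r / 2 by lra.
have H : cmod (q z - q w) <= 8 * M / (r / 2) * cmod (z - w).
  apply: (@taylor2_lipschitz q (r / 2) M (2 * M / d)) => //; try lra.
    move=> x /sh[x1 x2]; have [b T] := FT x x1; have [b' T'] := FT _ x2.
    by eexists; eexists; exact: taylor2_diffq T T'.
  move=> x y /sh[x1 x2] /sh[y1 y2]; rewrite /q -mulrBl cmodf ch.
  have -> : F (x + h) - F x - (F (y + h) - F y) =
    (F (x + h) - F (y + h)) - (F x - F y) by ring.
  rewrite [leRHS]mulrAC; apply: ler_wpM2r; first by rewrite invr_ge0 ltW.
  rewrite (le_trans (cmodB _ _))//.
  have k1 := FM (y + h) (x - y) y2; have k2 := FM y (x - y) y1.
  have E1 : y + h + (x - y) = x + h by ring.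
  have E2 : y + (x - y) = x by ring.
  rewrite E1 in k1; rewrite E2 in k2; have := k1 x2; have := k2 x1; lra.
have k1 := h1 h; rewrite ch in k1; have {}k1 := k1 dd1.
have k2 := h2 h; rewrite ch in k2; have {}k2 := k2 dd2.
have qz : cmod (q z - f z) <= e / 2.
  have -> : q z - f z = (F (z + h) - F z - f z * h) / h by rewrite /q; field.
  by rewrite cmodf ch ler_pdivrMr.
have qw : cmod (q w - f w) <= e / 2.
  have -> : q w - f w = (F (w + h) - F w - f w * h) / h by rewrite /q; field.
  by rewrite cmodf ch ler_pdivrMr.
have -> : 16 * M / r = 8 * M / (r / 2) by field; rewrite gt_eqF.
have -> : f z - f w = (q z - q w) - (q z - f z) + (q w - f w) by ring.
have := cmodD (q z - q w - (q z - f z)) (q w - f w).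
have := cmodB (q z - q w) (q z - f z); lra.
Qed.

Lemma cder_bound f z a K r : 0 < r -> cder f z a ->
  (forall h, cmod h < r -> cmod (f (z + h) - f z) <= K * cmod h) -> cmod a <= K.
Proof.
move=> r0 df fK; apply: le_eps_le => e e0.
have [d d0 hd] := df e e0.
pose t := Num.min d r / 2.
have m0 : 0 < Num.min d r by rewrite lt_min d0.
have td : t < d.
  have : Num.min d r <= d by rewrite ge_min lexx.
  rewrite /t; lra.
have tr : t < r.
  have : Num.min d r <= r by rewrite ge_min lexx orbT.
  rewrite /t; lra.
have t0 : 0 < t by rewrite /t divr_gt0.
have ct : cmod t%:C = t by rewrite cmod_real gtr0_norm.
have k1 := hd t%:C; rewrite ct in k1; have {}k1 := k1 td.
have k2 := fK t%:C; rewrite ct in k2; have {}k2 := k2 tr.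
rewrite -(ler_pM2r t0) -{1}ct -cmodM.
have -> : a * t%:C = (f (z + t%:C) - f z) - (f (z + t%:C) - f z - a * t%:C) by ring.
by rewrite (le_trans (cmodB _ _))//; lra.
Qed.

Lemma small_inv (e : R) : 0 < e -> exists N : nat, N.+1%:R^-1 < e.
Proof.
move=> e0; exists (Num.bound e^-1); rewrite invf_plt ?posrE ?ltr0Sn//.
rewrite (@lt_trans _ _ (Num.bound e^-1)%:R) ?ltr_nat//.
by rewrite archi_boundP// invr_ge0 ltW.
Qed.

(** The Cauchy estimate for [g n - g m] makes the slopes at 0 uniformly close and the derivatives
    [b n] bounded; an ultralimit of the latter is the derivative of [f]. *)
Lemma cder_uniform_limit f r : 0 < r ->
  (forall e, 0 < e -> exists2 g, forall z, cmod z < r -> exists a, cder g z a &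
     forall z, cmod z < r -> cmod (g z - f z) <= e) ->
  exists b, cder f 0 b.
Proof.
move=> r0 fg; have [U [UU Uoo]] := free_ultrafilter.
pose e n : R := n.+1%:R^-1.
have e0 n : 0 < e n by rewrite invr_gt0.
have eD (n m : nat) : (n <= m)%N -> e m <= e n by move=> nm; rewrite lef_pV2 ?posrE// ler_nat.
have /choice[g hg] : forall n, exists g, (forall z, cmod z < r -> exists a, cder g z a) /\
     forall z, cmod z < r -> cmod (g z - f z) <= e n.
  by move=> n; have [g g1 g2] := fg _ (e0 n); exists g.
have z0 : cmod (0 : R[i]) < r by rewrite cmod0.
have /choice[b hb] : forall n, exists b, cder (g n) 0 b.
  by move=> n; exact: (hg n).1.
pose K := 16 / r.
have K0 : 0 < K by rewrite divr_gt0.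
have r8 : 0 < r / 8 by lra.
have dg (n m : nat) h : cmod h <= r / 4 ->
    cmod ((g n h - g m h) - (g n 0 - g m 0)) <= K * (e n + e m) * cmod h.
  move=> hr; have -> : K * (e n + e m) * cmod h = 16 * (e n + e m) / r * cmod (h - 0).
    by rewrite subr0 /K; ring.
  apply: (@cder_lipschitz (fun z => g n z - g m z)) => //.
  - move=> z zr; have [a ha] := (hg n).1 z zr; have [a' ha'] := (hg m).1 z zr.
    by exists (a - a'); exact: cderB.
  - move=> z zr; have := (hg n).2 z zr; have := (hg m).2 z zr.
    have -> : g n z - g m z = (g n z - f z) - (g m z - f z) by ring.
    by have := cmodB (g n z - f z) (g m z - f z); lra.
  - by rewrite cmod0; lra.
have bb (n m : nat) : cmod (b n - b m) <= K * (e n + e m).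
  have r4 : 0 < r / 4 by lra.
  apply: (cder_bound r4 (cderB (hb n) (hb m))) => h hr.
  by rewrite add0r; apply: dg; exact: ltW.
have bM n : cmod (b n) <= cmod (b 0%N) + K * (e 0%N + e 0%N).
  have := cmod_sub (b n) (b 0%N); have := bb n 0%N; have := eD _ _ (leq0n n) => h1 h2 h3.
  have : K * (e n + e 0%N) <= K * (e 0%N + e 0%N) by rewrite ler_wpM2l ?lerD// ltW.
  lra.
have [bl hbl] := ulim_ex UU bM.
have bbl n : cmod (bl - b n) <= K * (e n + e n).
  apply: (ulim_le UU hbl); apply: filterS (U_ge Uoo n) => m /= nm.
  by rewrite (le_trans (bb m n))// ler_wpM2l ?(ltW K0)// lerD// eD.
(* Obtained from [dg] by letting [m] grow, which replaces [g m] by [f]. *)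
have gf n h : cmod h <= r / 4 ->
    cmod ((g n h - f h) - (g n 0 - f 0)) <= K * (e n + e n) * cmod h.
  move=> hr; apply: le_eps_le => eps eps0.
  have eps2 : 0 < eps / 2 by lra.
  have [N hN] := small_inv eps2.
  pose m := maxn n N.
  have em : e m <= eps / 2 by rewrite (le_trans _ (ltW hN))// eD// leq_maxr.
  have emn : e m <= e n by rewrite eD// leq_maxl.
  have hr' : cmod h < r by lra.
  have := dg n m h hr; have := (hg m).2 h hr'; have := (hg m).2 0 z0.
  have -> : g n h - f h - (g n 0 - f 0) =
    ((g n h - g m h) - (g n 0 - g m 0)) + (g m h - f h) - (g m 0 - f 0) by ring.
  have := cmodB ((g n h - g m h) - (g n 0 - g m 0) + (g m h - f h)) (g m 0 - f 0).
  have := cmodD ((g n h - g m h) - (g n 0 - g m 0)) (g m h - f h).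
  have : K * (e n + e m) * cmod h <= K * (e n + e n) * cmod h.
    by rewrite ler_wpM2r ?cmod_ge0// ler_wpM2l ?(ltW K0)// lerD.
  lra.
exists bl => eps eps0.
have eK : 0 < eps / (8 * K) by apply: divr_gt0 => //; exact: mulr_gt0.
have [n hn] := small_inv eK.
have hKn : K * (e n + e n) <= eps / 4.
  have -> : eps / 4 = K * (eps / (8 * K) + eps / (8 * K)) by field; rewrite gt_eqF.
  by rewrite ler_wpM2l ?(ltW K0)// lerD// ltW.
have eps2 : 0 < eps / 2 by lra.
have [d d0 hd] := hb n _ eps2.
have r4 : 0 < r / 4 by lra.
exists (Num.min d (r / 4)); first by rewrite lt_min d0 r4.
move=> h; rewrite lt_min => /andP[h1 h2].
have k1 := hd h h1; have k2 := gf n h (ltW h2); have k3 := bbl n.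
rewrite add0r in k1 *.
have -> : f h - f 0 - bl * h = (g n h - g n 0 - b n * h) - ((g n h - f h) - (g n 0 - f 0))
  - (bl - b n) * h by ring.
rewrite (le_trans (cmodB _ _))// cmodM.
have := cmodB (g n h - g n 0 - b n * h) (g n h - f h - (g n 0 - f 0)).
have := ler_wpM2r (cmod_ge0 h) k3; have := ler_wpM2r (cmod_ge0 h) hKn; lra.
Qed.

Lemma cder_mulid f z a : cder f z a -> cder (fun x => x * f x) z (f z + z * a).
Proof.
move=> df e e0.
have z1 : 0 < 2 * (cmod z + 1) by have := cmod_ge0 z; lra.
have a1 : 0 < cmod a + 1 by have := cmod_ge0 a; lra.
have e2 : 0 < e / (2 * (cmod z + 1)) by rewrite divr_gt0.
have [d d0 hd] := df _ e2.
exists (Num.min d (Num.min 1 (e / 2 / (cmod a + 1)))).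
  by rewrite !lt_min d0 ltr01 !divr_gt0.
move=> h; rewrite !lt_min => /and3P[/hd k1 h1]; rewrite ltr_pdivlMr// => h2.
have -> : (z + h) * f (z + h) - z * f z - (f z + z * a) * h =
  (z + h) * (f (z + h) - f z - a * h) + a * h * h by ring.
rewrite (le_trans (cmodD _ _))// !cmodM.
have k2 : cmod (z + h) <= cmod z + 1 by have := cmodD z h; lra.
have k3 := ler_pM (cmod_ge0 _) (cmod_ge0 _) k2 k1.
have E : (cmod z + 1) * (e / (2 * (cmod z + 1)) * cmod h) = e / 2 * cmod h.
  by field; rewrite gt_eqF//; have := cmod_ge0 z; lra.
rewrite E in k3; have h0 := cmod_ge0 h; have a0 := cmod_ge0 a.
have : cmod a * cmod h * cmod h <= e / 2 * cmod h by rewrite ler_wpM2r//; lra.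
lra.
Qed.

(* [z * f z] is differentiable, hence a uniform limit of difference quotients of
   its primitive; their slopes at 0 are differentiable and converge to [f]. *)
Lemma cder_removable f r : 0 < r -> ccont f 0 ->
  (forall z, cmod z < r -> z != 0 -> exists a, cder f z a) -> exists b, cder f 0 b.
Proof.
move=> r0 fc df.
have [d d0 hd] := fc _ ltr01.
pose r1 := Num.min d r; have r10 : 0 < r1 by rewrite lt_min d0.
have r1r : r1 <= r by rewrite ge_min lexx orbT.
have r1d : r1 <= d by rewrite ge_min lexx.
pose N := cmod (f 0) + 1.
have fN z : cmod z < r1 -> cmod (f z) <= N.
  move=> zr; have := hd z (lt_le_trans zr r1d); rewrite add0r.
  by have := cmod_sub (f z) (f 0); rewrite /N; lra.
pose p z := z * f z.
have dp z : cmod z < r1 -> exists a, cder p z a.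
  move=> zr; have [->|z0] := eqVneq z 0; last first.
    have [a da] := df z (lt_le_trans zr r1r) z0.
    by eexists; exact: cder_mulid da.
  exists (f 0) => e e0; have [d' d'0 hd'] := fc e e0; exists d' => // h /hd'.
  rewrite /p !add0r mul0r subr0 => H.
  by rewrite [f 0 * h]mulrC -mulrBr cmodM mulrC ler_wpM2r ?cmod_ge0.
have p0 : cder p 0 (f 0).
  move=> e e0; have [d' d'0 hd'] := fc e e0; exists d' => // h /hd'.
  rewrite /p !add0r mul0r subr0 => H.
  by rewrite [f 0 * h]mulrC -mulrBr cmodM mulrC ler_wpM2r ?cmod_ge0.
have pM z : cmod z < r1 -> cmod (p z) <= r1 * N.
  by move=> zr; rewrite /p cmodM ler_pM ?cmod_ge0 ?fN// ltW.
have plip := cder_lipschitz r10 dp pM.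
have [F [FT _ FB]] := goursat_primitive r10 dp pM.
pose L := 16 * (r1 * N) / r1.
have N0 : 0 < N by rewrite /N; have := cmod_ge0 (f 0); lra.
have L0 : 0 < L by rewrite /L divr_gt0// !mulr_gt0.
(* Points [x] of this disc, and all points within [t < rho] of them, stay in the discs of radii
   [r1 / 8] and [r1 / 4] where [plip] applies. *)
pose rho := r1 / 16.
have rho0 : 0 < rho by rewrite /rho; lra.
have rho4 : 0 < rho / 4 by lra.
apply: (cder_uniform_limit rho4) => e e0.
have KL : 0 < 16 * L / rho by rewrite divr_gt0// mulr_gt0.
pose t := Num.min (e / (16 * L / rho)) rho / 2.
have m0 : 0 < Num.min (e / (16 * L / rho)) rho.
  by rewrite lt_min rho0 andbT; apply: divr_gt0.
have t0 : 0 < t by rewrite /t divr_gt0.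
have trho : t < rho.
  have : Num.min (e / (16 * L / rho)) rho <= rho by rewrite ge_min lexx orbT.
  rewrite /t; lra.
have te : 16 * L / rho * t <= e.
  have : Num.min (e / (16 * L / rho)) rho <= e / (16 * L / rho) by rewrite ge_min lexx.
  rewrite ler_pdivlMr// => H; have : t * (16 * L / rho) <= Num.min (e / (16 * L / rho)) rho * (16 * L / rho).
    by rewrite ler_wpM2r ?(ltW KL)// /t; lra.
  lra.
pose h : R[i] := t%:C.
have ch : cmod h = t by rewrite cmod_real gtr0_norm.
have h0 : h != 0 by rewrite -cmod_gt0 ch.
pose q x := (F (x + h) - F x) * h^-1.
have sh x : cmod x < rho -> cmod x < r1 /\ cmod (x + h) < r1.
  by rewrite /rho in trho *; move=> xr; split; [|have := cmodD x h]; lra.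
have qT x : cmod x < rho -> exists a b, taylor2 q x a b.
  move=> /sh[x1 x2]; have [b T] := FT x x1; have [b' T'] := FT _ x2.
  by eexists; eexists; exact: taylor2_diffq T T'.
have qp x : cmod x < rho -> cmod (q x - p x) <= L * t.
  move=> xr; have [x1 x2] := sh x xr.
  have -> : q x - p x = (F (x + h) - F x - p x * h) / h by rewrite /q; field.
  rewrite cmodf ch ler_pdivrMr// -ch; apply: FB => // w wr wx.
  rewrite ch in wx; have := cmod_sub w x; rewrite /rho in xr trho => H.
  have h1 : cmod w <= r1 / 4 by lra.
  have h2 : cmod x <= r1 / 8 by lra.
  have := plip w x h1 h2; rewrite -/L ch => H'.
  by rewrite (le_trans H')// ler_wpM2l// ltW.
have dqp x : cmod x < rho -> exists a, cder (fun z => q z - p z) x a.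
  move=> xr; have [x1 _] := sh x xr; have [a [b T]] := qT x xr.
  have [a' ha'] := dp x x1; exists (a - a'); exact: cderB (taylor2_cder T) ha'.
(* The factor [cmod x] allows division by [x]: uniform closeness of [q] to [p] becomes uniform
   closeness of the slopes of [q] at 0 to [f]. *)
have elip x : cmod x <= rho / 4 ->
    cmod ((q x - p x) - (q 0 - p 0)) <= 16 * L / rho * t * cmod x.
  move=> xr; have := cder_lipschitz rho0 dqp qp xr; move=> /(_ 0).
  rewrite cmod0 subr0; have -> : 16 * (L * t) / rho = 16 * L / rho * t by ring.
  by apply; lra.
have z0 : cmod (0 : R[i]) < rho by rewrite cmod0.
have [a [b Tq]] := qT 0 z0.
exists (fun z => if z == 0 then a else (q z - q 0) / (z - 0)).
  move=> z zr; have [->|zn0] := eqVneq z 0; first by exists b; exact: taylor2_slope_cder.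
  have zr' : cmod z < rho by lra.
  have [a1 [b1 T1]] := qT z zr'; have [a2 [b2 T2]] := taylor2_slope a T1 zn0.
  by exists a2; exact: taylor2_cder T2.
move=> z zr; have [->|zn0] := eqVneq z 0.
  rewrite (le_trans _ te)//.
  apply: (cder_bound rho4 (cderB (taylor2_cder Tq) p0)) => k kr.
  by rewrite add0r; apply: elip; exact: ltW.
have -> : (q z - q 0) / (z - 0) - f z = ((q z - p z) - (q 0 - p 0)) / z.
  by rewrite /p; field.
rewrite cmodf ler_pdivrMr ?cmod_gt0//.
rewrite (le_trans (elip z (ltW zr)))// ler_wpM2r ?cmod_ge0//.
Qed.

End Regularity.

(** * Roots and functions of several variables *)

Section RootsOfUnity.
Variable R : realType.
Implicit Types (a b z w : R[i]).

Lemma cmod_unity k z : (0 < k)%N -> z ^+ k = 1 -> cmod z = 1.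
Proof.
move=> k0 zk; apply/eqP; rewrite -(@pexpr_eq1 _ _ k) ?cmod_ge0//.
by rewrite -cmodX zk cmod1.
Qed.

Lemma cmod_sum n (F : 'I_n -> R[i]) : cmod (\sum_i F i) <= \sum_i cmod (F i).
Proof.
elim/big_ind2: _ => [|x y x' y' h1 h2|//]; first by rewrite cmod0.
by rewrite (le_trans (cmodD _ _))// lerD.
Qed.

(** If [z = a / b] differs from 1, its first [k] powers sum to 0. Then [k] is the sum of the
    [1 - z ^+ i], at most [k ^+ 2 * cmod (z - 1)], which is less than [k]. *)
Lemma unity_roots_gap k a b : (0 < k)%N -> a ^+ k = 1 -> b ^+ k = 1 ->
  cmod (a - b) < k%:R^-1 -> a = b.
Proof.
move=> k0 ak bk ab; have b1 := cmod_unity k0 bk.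
have b0 : b != 0 by rewrite -cmod_gt0 b1.
pose z := a / b.
have zk : z ^+ k = 1 by rewrite /z expr_div_n ak bk divr1.
have z1 : cmod (z - 1) < k%:R^-1.
  have -> : z - 1 = (a - b) / b by rewrite /z; field.
  by rewrite cmodf b1 divr1.
have [zE|zn1] := eqVneq z 1; first by rewrite -(divfK b0 a) -/z zE mul1r.
exfalso.
have S0 : \sum_(i < k) z ^+ i = 0.
  apply/eqP; have := subrX1 z k; rewrite zk subrr => /esym/eqP.
  by rewrite mulf_eq0 subr_eq0 (negPf zn1).
have pw i : cmod (1 - z ^+ i) <= i%:R * cmod (z - 1).
  elim: i => [|i IH]; first by rewrite expr0 subrr cmod0 mul0r.
  have -> : 1 - z ^+ i.+1 = (1 - z ^+ i) - z ^+ i * (z - 1) by rewrite exprSr; ring.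
  rewrite (le_trans (cmodB _ _))// cmodM cmodX (cmod_unity k0 zk) expr1n.
  by rewrite -natr1; lra.
have kS : k%:R = \sum_(i < k) (1 - z ^+ i).
  by rewrite sumrB S0 subr0 sumr_const card_ord.
have k0' : (0 : R) < k%:R by rewrite ltr0n.
have : k%:R <= \sum_(i < k) (k%:R * cmod (z - 1) : R).
  rewrite -[leLHS]cmod_nat kS (le_trans (cmod_sum _))//; apply: ler_sum => i _.
  by rewrite (le_trans (pw i))// ler_wpM2r ?cmod_ge0// ler_nat ltnW.
rewrite sumr_const card_ord -[(_ * _) *+ k]mulr_natl leNgt => /negP; apply.
by rewrite -[ltRHS]mulr1 ltr_pM2l// mulrC -ltr_pdivlMr// div1r.
Qed.

(** The distances from [s] to the [k] roots of ['X^k - (s ^+ k + a)] have product [cmod a], so one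
    of them is at most [tau]. *)
Lemma near_root k s a (tau : R) : (0 < k)%N -> 0 < tau -> cmod a < tau ^+ k ->
  exists2 t, cmod t <= tau & (s + t) ^+ k = s ^+ k + a.
Proof.
move=> k0 tau0 ha; pose p : {poly R[i]} := 'X^k - (s ^+ k + a)%:P.
have pm : p \is monic by rewrite monicXnsubC.
have [rs prs] := closed_field_poly_normal p.
rewrite (eqP pm) scale1r in prs.
have szr : size rs = k.
  have := congr1 (fun q : {poly _} => size q) prs.
  by rewrite size_XnsubC// size_prod_XsubC => -[].
have [[t [trs ht]]|nt] := pselect (exists t, t \in rs /\ cmod (s - t) <= tau).
  exists (t - s); first by rewrite cmodBC.
  have tk : t ^+ k = s ^+ k + a.
    have : root p t by rewrite prs root_prod_XsubC.
    by rewrite /root /p !hornerE subr_eq0 => /eqP.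
  by rewrite (addrC s (t - s)) subrK.
exfalso; move: ha; apply/negP; rewrite -leNgt.
have : p.[s] = - a by rewrite /p !hornerE; ring.
rewrite prs horner_prod => /(congr1 (@cmod R)); rewrite cmodN => <-.
have : forall t, t \in rs -> tau <= cmod (s - t).
  move=> t trs; rewrite leNgt; apply/negP => h; apply: nt; exists t.
  by split => //; exact: ltW.
rewrite -szr; elim: rs {prs szr nt} => [|x rs IH] h; first by rewrite big_nil cmod1.
rewrite big_cons /= exprS cmodM !hornerE ler_pM ?exprn_ge0 ?(ltW tau0)//.
  by apply: h; rewrite inE eqxx.
by apply: IH => t trs; apply: h; rewrite inE trs orbT.
Qed.

Lemma cder_exp k s : cder (fun x : R[i] => x ^+ k.+1) s (k.+1%:R * s ^+ k).
Proof.
elim: k => [|k IH].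
  move=> e e0; exists 1 => // h _.
  have -> : (s + h) ^+ 1 - s ^+ 1 - 1%:R * s ^+ 0 * h = 0 by ring.
  by rewrite cmod0 mulr_ge0 ?cmod_ge0// ltW.
have := cder_mulid IH.
have -> : s ^+ k.+1 + s * (k.+1%:R * s ^+ k) = k.+2%:R * s ^+ k.+1.
  by rewrite exprS -[k.+2%:R]natr1; ring.
by apply: cder_ext; exists 1 => // h _; rewrite exprS.
Qed.

(** Differentiability of a local k-th root, without constructing a branch: any root close enough to
    [s] obeys the expansion, with [c] the inverse of the derivative of the power map. *)
Lemma near_root_diff k s : (0 < k)%N -> s != 0 -> exists2 c, c != 0 &
  forall e : R, 0 < e -> exists2 d : R, 0 < d & forall a, cmod a < d ->
    exists2 t, (s + t) ^+ k = s ^+ k + a & cmod (t - c * a) <= e * cmod a.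
Proof.
case: k => // k _ s0; pose c := k.+1%:R * s ^+ k.
have c0 : c != 0 by rewrite mulf_neq0 ?expf_neq0// pnatr_eq0.
have cc : 0 < cmod c by rewrite cmod_gt0.
exists c^-1; first by rewrite invr_eq0.
(* The first bound gives [cmod c * cmod t <= 2 * cmod a]; the second then makes the error at most
   [e * cmod a]. *)
move=> e e0; pose eta := Num.min (cmod c / 2) (e * cmod c ^+ 2 / 2).
have eta0 : 0 < eta.
  by rewrite lt_min; apply/andP; split; apply: divr_gt0 => //; rewrite mulr_gt0 ?exprn_gt0.
have eta1 : eta <= cmod c / 2 by rewrite ge_min lexx.
have eta2 : eta <= e * cmod c ^+ 2 / 2 by rewrite ge_min lexx orbT.
have [d d0 hd] := cder_exp k s eta0; rewrite -/c in hd.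
have d2 : 0 < d / 2 by lra.
exists ((d / 2) ^+ k.+1); first by rewrite exprn_gt0.
move=> a ha; have [t ht st] := near_root s (ltn0Sn k) d2 ha.
exists t => //.
have := hd t (le_lt_trans ht _); rewrite st (_ : s ^+ k.+1 + a - s ^+ k.+1 - c * t = a - c * t); last by ring.
move=> H; have {}H : cmod (a - c * t) <= eta * cmod t by apply: H; lra.
have -> : t - c^-1 * a = - ((a - c * t) / c) by field.
rewrite cmodN cmodf ler_pdivrMr//.
have h1 : cmod c * cmod t <= cmod (a - c * t) + cmod a.
  by rewrite -cmodM; have := cmod_sub (c * t) a; rewrite (cmodBC (c * t)).
have t0 := cmod_ge0 t.
have h2 : cmod c * cmod t <= 2 * cmod a.
  have : eta * cmod t <= cmod c / 2 * cmod t by rewrite ler_wpM2r.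
  lra.
have h3 : eta * cmod t <= e * cmod c ^+ 2 / 2 * cmod t by rewrite ler_wpM2r.
have h4 : e * cmod c / 2 * (cmod c * cmod t) <= e * cmod c / 2 * (2 * cmod a).
  by rewrite ler_wpM2l// divr_ge0 ?mulr_ge0// ltW.
lra.
Qed.

Lemma same_power k (om s t : R[i]) : (0 < k)%N -> k.-primitive_root om -> s ^+ k = t ^+ k ->
  exists i, t = om ^+ i * s.
Proof.
move=> k0 pom st; have [s0|s0] := eqVneq s 0.
  exists 0%N; move: st; rewrite s0 mulr0 expr0n gtn_eqF//= => /esym/eqP.
  by rewrite expf_eq0 => /andP[_ /eqP].
have : (t / s) ^+ k = 1 by rewrite expr_div_n -st divff// expf_neq0.
by move=> /(prim_rootP pom)[i ti]; exists i; rewrite -ti divfK.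
Qed.

End RootsOfUnity.

(** * Differentiability and Cauchy estimates in several variables *)

Section SeveralVariables.
Variables (R : realType).

Section Norm.
Variable n : nat.
Implicit Types (x y v A : 'rV[R[i]]_n) (g : 'rV[R[i]]_n -> R[i]).

Definition vnorm x : R := \big[Order.max/0]_j cmod (x 0 j).

Lemma vnorm_ge0 x : 0 <= vnorm x.
Proof. exact: bigmax_ge_id. Qed.
Lemma cmod_vnorm x j : cmod (x 0 j) <= vnorm x.
Proof. exact: le_bigmax. Qed.
Lemma vnorm_le x e : 0 <= e -> (forall j, cmod (x 0 j) <= e) -> vnorm x <= e.
Proof. by move=> e0 h; apply: bigmax_le. Qed.
Lemma vnorm_lt x e : 0 < e -> (forall j, cmod (x 0 j) < e) -> vnorm x < e.
Proof. by move=> e0 h; apply: bigmax_lt. Qed.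
Lemma vnormD x y : vnorm (x + y) <= vnorm x + vnorm y.
Proof.
apply: vnorm_le => [|j]; first by rewrite addr_ge0 ?vnorm_ge0.
by rewrite mxE (le_trans (cmodD _ _))// lerD ?cmod_vnorm.
Qed.
Lemma vnormZ a x : vnorm (a *: x) = cmod a * vnorm x.
Proof.
apply/eqP; rewrite eq_le; apply/andP; split.
  apply: vnorm_le => [|j]; first by rewrite mulr_ge0 ?vnorm_ge0 ?cmod_ge0.
  by rewrite mxE cmodM ler_wpM2l ?cmod_ge0 ?cmod_vnorm.
have [->|a0] := eqVneq a 0; first by rewrite cmod0 mul0r vnorm_ge0.
have ca : 0 < cmod a by rewrite cmod_gt0.
rewrite mulrC -ler_pdivlMr//; apply: vnorm_le => [|j].
  by rewrite divr_ge0 ?vnorm_ge0 ?cmod_ge0.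
rewrite ler_pdivlMr// mulrC -cmodM.
by have := cmod_vnorm (a *: x) j; rewrite mxE.
Qed.
Lemma vnorm0 : vnorm 0 = 0.
Proof. by rewrite -(scale0r (0 : 'rV[R[i]]_n)) vnormZ cmod0 mul0r. Qed.
Lemma vnorm_eq0 x : vnorm x = 0 -> x = 0.
Proof.
move=> x0; apply/rowP => j; rewrite mxE; apply/eqP; rewrite -cmod_le0 -x0.
exact: cmod_vnorm.
Qed.

Definition dot A v : R[i] := \sum_j A 0 j * v 0 j.

Lemma dotZ A a v : dot A (a *: v) = a * dot A v.
Proof. by rewrite /dot mulr_sumr; apply: eq_bigr => j _; rewrite mxE; ring. Qed.

Lemma dot_le A : exists2 K : R, 0 < K & forall v, cmod (dot A v) <= K * vnorm v.
Proof.
exists (\sum_j cmod (A 0 j) + 1).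
  have : 0 <= \sum_j cmod (A 0 j) by apply: sumr_ge0 => j _; exact: cmod_ge0.
  lra.
move=> v; rewrite (le_trans (cmod_sum _))// mulrDl mul1r mulr_suml.
rewrite (@le_trans _ _ (\sum_j cmod (A 0 j) * vnorm v))// ?lerDl ?vnorm_ge0//.
by apply: ler_sum => j _; rewrite cmodM ler_wpM2l ?cmod_ge0 ?cmod_vnorm.
Qed.

Definition vder g x A := forall e : R, 0 < e -> exists2 d : R, 0 < d &
  forall v, vnorm v < d -> cmod (g (x + v) - g x - dot A v) <= e * vnorm v.

Lemma vder_cont g x A : vder g x A -> forall e : R, 0 < e -> exists2 d : R, 0 < d &
  forall v, vnorm v < d -> cmod (g (x + v) - g x) <= e.
Proof.
move=> dg e e0; have [d d0 hd] := dg _ ltr01.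
have [K K0 hK] := dot_le A.
have K1 : 0 < K + 1 by lra.
exists (Num.min d (e / (K + 1))); first by rewrite lt_min d0 divr_gt0.
move=> v; rewrite lt_min ltr_pdivlMr// => /andP[/hd h1 h2].
have := cmod_sub (g (x + v) - g x) (dot A v); have := hK v; lra.
Qed.

Lemma vder_line g x v z A : vder g (x + z *: v) A ->
  cder (fun z => g (x + z *: v)) z (dot A v).
Proof.
move=> dg e e0; have v1 : 0 < vnorm v + 1 by have := vnorm_ge0 v; lra.
have e1 : 0 < e / (vnorm v + 1) by rewrite divr_gt0.
have [d d0 hd] := dg _ e1.
exists (d / (vnorm v + 1)); first by rewrite divr_gt0.
move=> h; rewrite ltr_pdivlMr// => hh.
have hv : vnorm (h *: v) <= cmod h * (vnorm v + 1).
  by rewrite vnormZ ler_wpM2l ?cmod_ge0//; lra.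
have := hd (h *: v) (le_lt_trans hv hh); rewrite dotZ -(addrA x) -scalerDl [h * _]mulrC.
move=> /le_trans; apply.
have -> : e * cmod h = e / (vnorm v + 1) * (cmod h * (vnorm v + 1)).
  by field; rewrite gt_eqF.
by rewrite ler_wpM2l// ltW.
Qed.

(** The one-variable estimate on the complex line through [y] and [x], between the parameters 0 and
    1. The radius [r / 16] keeps 1 within a quarter of the parameter disc. *)
Lemma vder_lipschitz g r M : 0 < r -> (forall x, vnorm x < r -> exists A, vder g x A) ->
  (forall x, vnorm x < r -> cmod (g x) <= M) ->
  forall x y, vnorm x <= r / 16 -> vnorm y <= r / 16 ->
  cmod (g x - g y) <= 32 * M / r * vnorm (x - y).
Proof.
move=> r0 dg gM x y xr yr; pose v := x - y.
have [v0|v0] := eqVneq (vnorm v) 0.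
  by move: (v0) => /vnorm_eq0/eqP; rewrite subr_eq0 => /eqP ->; rewrite !subrr cmod0 vnorm0 mulr0.
have vp : 0 < vnorm v by rewrite lt_def v0 vnorm_ge0.
have vr : vnorm v <= r / 8.
  by have := vnormD x (- y); rewrite -scaleN1r vnormZ cmodN cmod1 scaleN1r mul1r /v; lra.
pose r' := r / 2 / vnorm v; have r'0 : 0 < r' by rewrite !divr_gt0.
have dom z : cmod z < r' -> vnorm (y + z *: v) < r.
  rewrite /r' ltr_pdivlMr// => hz; rewrite (le_lt_trans (vnormD _ _))// vnormZ; lra.
have := @cder_lipschitz _ (fun z => g (y + z *: v)) r' M r'0 _ _ 1 0.
rewrite scale1r scale0r addr0 subr0 cmod1 cmod0 mulr1.
have -> : y + v = x by rewrite /v addrC subrK.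
have -> : 16 * M / r' = 32 * M / r * vnorm v by rewrite /r'; field; rewrite !gt_eqF.
apply.
- by move=> z /dom zr; have [A dA] := dg _ zr; exists (dot A v); exact: vder_line.
- by move=> z /dom; exact: gM.
- by rewrite /r'; rewrite ler_pdivlMr// ler_pdivlMr//; lra.
- by rewrite divr_ge0// ltW.
Qed.

End Norm.
End SeveralVariables.

(** * Functions invariant under a rotation of the first coordinate *)

Section FirstCoordinate.
Variables (R : realType) (n : nat).
Implicit Types (x y v A : 'rV[R[i]]_n.+1) (g u : 'rV[R[i]]_n.+1 -> R[i]) (a b s t om : R[i]).

Definition setc x a : 'rV[R[i]]_n.+1 := \row_j (if j == ord0 then a else x 0 j).

Lemma setcE x a : setc x a 0 ord0 = a.
Proof. by rewrite mxE eqxx. Qed.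
Lemma setcK x : setc x (x 0 ord0) = x.
Proof. by apply/rowP => j; rewrite mxE; case: eqP => // ->. Qed.
Lemma setc_setc x a b : setc (setc x a) b = setc x b.
Proof. by apply/rowP => j; rewrite !mxE; case: eqP. Qed.
Lemma setcD x y a b : setc x a + setc y b = setc (x + y) (a + b).
Proof. by apply/rowP => j; rewrite !mxE; case: eqP. Qed.
Lemma setcB x y a b : setc x a - setc y b = setc (x - y) (a - b).
Proof. by apply/rowP => j; rewrite !mxE; case: eqP. Qed.
Lemma setcZ x a b : b *: setc x a = setc (b *: x) (b * a).
Proof. by apply/rowP => j; rewrite !mxE; case: eqP. Qed.
Lemma setc_line x a : setc x a = setc x 0 + a *: setc 0 1.
Proof. by apply/rowP => j; rewrite !mxE; case: eqP => _; rewrite ?mulr1 ?add0r ?mulr0 ?addr0. Qed.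

Lemma vnorm_setc_le x a e : vnorm x <= e -> cmod a <= e -> vnorm (setc x a) <= e.
Proof.
move=> xe ae; apply: vnorm_le => [|j]; first exact: le_trans (vnorm_ge0 _) xe.
by rewrite mxE; case: eqP => // _; rewrite (le_trans (cmod_vnorm _ _)).
Qed.
Lemma vnorm_setc_lt x a e : vnorm x < e -> cmod a < e -> vnorm (setc x a) < e.
Proof.
move=> xe ae; apply: vnorm_lt => [|j]; first exact: le_lt_trans (vnorm_ge0 _) xe.
by rewrite mxE; case: eqP => // _; rewrite (le_lt_trans (cmod_vnorm _ _)).
Qed.
Lemma vnorm_setc0 x : vnorm (setc x 0) <= vnorm x.
Proof. by rewrite vnorm_setc_le// cmod0 vnorm_ge0. Qed.

Lemma dot_setcr A v t : dot A (setc v t) = A 0 ord0 * t + dot A (setc v 0).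
Proof.
rewrite /dot !big_ord_recl !mxE eqxx mulr0 add0r; congr (_ + _).
by apply: eq_bigr => j _; rewrite !mxE.
Qed.
Lemma dot_setcl A v a : dot (setc A a) v = a * v 0 ord0 + dot A (setc v 0).
Proof.
rewrite /dot !big_ord_recl !mxE eqxx mulr0 add0r; congr (_ + _).
by apply: eq_bigr => j _; rewrite !mxE.
Qed.

Lemma pow_lt (k : nat) s (e : R) : (0 < k)%N -> 0 < e -> (cmod (s ^+ k) < e ^+ k) = (cmod s < e).
Proof. by move=> k0 e0; rewrite cmodX ltr_pXn2r ?nnegrE ?cmod_ge0 ?(ltW e0). Qed.

Section Factor.
Variables (k : nat) (om : R[i]) (g : 'rV[R[i]]_n.+1 -> R[i]) (r M : R).
Hypothesis k0 : (0 < k)%N.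
Hypothesis pom : k.-primitive_root om.
Hypothesis r0 : 0 < r.
Hypothesis r1 : r <= 1.
Hypothesis dg : forall x, vnorm x < r -> exists A, vder g x A.
Hypothesis gM : forall x, vnorm x < r -> cmod (g x) <= M.
Hypothesis gom : forall x, vnorm x < r -> g (setc x (om * x 0 ord0)) = g x.

(** [q] is the radius of validity of [vder_lipschitz]; [rho] is its k-th power, so that roots of
    first coordinates in the [rho]-ball stay below [q]. *)
Let q := r / 16.
Let q0 : 0 < q. Proof. by rewrite divr_gt0. Qed.
Let rho := q ^+ k.
Let rho0 : 0 < rho. Proof. by rewrite exprn_gt0. Qed.
Let rhoq : rho <= q.
Proof.
have q1 : q <= 1 by rewrite /q; have := r1; have := r0; lra.
by rewrite /rho -(prednK k0) exprS ger_pMr// exprn_ile1// ltW.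
Qed.
Let qr : q < r. Proof. by rewrite /q; have := r0; lra. Qed.

(* By invariance the value does not depend on the choice of the k-th root. *)
Definition descend y := g (setc y (k.-root (y 0 ord0))).

Let g_omX i x : vnorm x < r -> g (setc x (om ^+ i * x 0 ord0)) = g x.
Proof.
move=> xr; elim: i => [|i <-]; first by rewrite expr0 mul1r setcK.
have /gom : vnorm (setc x (om ^+ i * x 0 ord0)) < r.
  apply: vnorm_setc_lt => //; rewrite cmodM cmodX.
  rewrite (cmod_unity k0 (prim_expr_order pom)) expr1n mul1r.
  exact: le_lt_trans (cmod_vnorm _ _) xr.
by rewrite setcE setc_setc mulrA -exprS.
Qed.

Let dom y s : vnorm y < rho -> s ^+ k = y 0 ord0 -> vnorm (setc y s) < q.
Proof.
move=> yr sy; apply: vnorm_setc_lt; first exact: lt_le_trans yr rhoq.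
by rewrite -(pow_lt _ k0 q0) sy (le_lt_trans (cmod_vnorm _ _)).
Qed.

Lemma descend_root y s : vnorm y < rho -> s ^+ k = y 0 ord0 -> descend y = g (setc y s).
Proof.
move=> yr sy; rewrite /descend; set t := k.-root _.
have tk : s ^+ k = t ^+ k by rewrite sy rootCK.
have [i ti] := same_power k0 pom tk.
have := g_omX i (lt_trans (dom yr sy) qr).
by rewrite setcE setc_setc -ti.
Qed.

Let dom_setc y a : vnorm y < rho -> cmod a < rho -> vnorm (setc y a) < rho.
Proof. exact: vnorm_setc_lt. Qed.

Let descend_setc y a s : vnorm y < rho -> cmod a < rho -> s ^+ k = a ->
  descend (setc y a) = g (setc y s).
Proof. by move=> yr ar sa; rewrite (@descend_root _ s) ?setcE ?dom_setc// setc_setc. Qed.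

(** Chain rule through a local k-th root: by [descend_root], the root [s + t] near [s] may replace
    the one used in the definition of [descend]. *)
Lemma descend_vder_off y : vnorm y < rho -> y 0 ord0 != 0 -> exists A, vder descend y A.
Proof.
move=> yr y0; pose s := k.-root (y 0 ord0).
have sk : s ^+ k = y 0 ord0 by rewrite rootCK.
have s0 : s != 0 by apply: contra_neq y0 => s0; rewrite -sk s0 expr0n gtn_eqF.
have xr := lt_trans (dom yr sk) qr.
have [A dA] := dg xr.
have [c c0 hc] := near_root_diff k0 s0.
exists (setc A (A 0 ord0 * c)) => e e0.
(* Bounds [vnorm (setc v t)] relative to [vnorm v], as [cmod t <= (cmod c + 1) * vnorm v]. *)
pose Kp := 1 + (cmod c + 1).
have Kp0 : 0 < Kp by rewrite /Kp; have := cmod_ge0 c; lra.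
have e1 : 0 < e / (2 * Kp) by rewrite divr_gt0// mulr_gt0.
have [d d0 hd] := dA _ e1.
pose e2 := Num.min 1 (e / (2 * (cmod (A 0 ord0) + 1))).
have A1 : 0 < 2 * (cmod (A 0 ord0) + 1) by have := cmod_ge0 (A 0 ord0); lra.
have e20 : 0 < e2 by rewrite lt_min ltr01 divr_gt0.
have e21 : e2 <= 1 by rewrite ge_min lexx.
have e22 : cmod (A 0 ord0) * e2 <= e / 2.
  have : e2 <= e / (2 * (cmod (A 0 ord0) + 1)) by rewrite ge_min lexx orbT.
  by rewrite ler_pdivlMr//; lra.
have [d' d'0 hd'] := hc _ e20.
exists (Num.min (Num.min (d / Kp) d') (rho - vnorm y)).
  by rewrite !lt_min divr_gt0// d'0 subr_gt0.
move=> v; rewrite !lt_min ltr_pdivlMr// => /andP[/andP[h1 h2] h3].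
have yvr : vnorm (y + v) < rho by have := vnormD y v; lra.
have v0 := cmod_vnorm v ord0; have vn := vnorm_ge0 v.
have [t st ht] := hd' (v 0 ord0) (le_lt_trans v0 h2).
rewrite (descend_root yr sk) (@descend_root _ (s + t)) ?mxE ?st ?sk//.
rewrite -setcD dot_setcl.
have tle : cmod t <= (cmod c + 1) * vnorm v.
  have := cmod_sub t (c * v 0 ord0); rewrite cmodM.
  have : cmod c * cmod (v 0 ord0) <= cmod c * vnorm v by rewrite ler_wpM2l ?cmod_ge0.
  have : e2 * cmod (v 0 ord0) <= 1 * vnorm v by rewrite ler_pM ?cmod_ge0// ltW.
  lra.
have vt : vnorm (setc v t) <= Kp * vnorm v.
  have c1 := cmod_ge0 c; have cv : 0 <= cmod c * vnorm v by rewrite mulr_ge0.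
  by apply: vnorm_setc_le; rewrite /Kp; lra.
have vtd : vnorm (setc v t) < d by rewrite (le_lt_trans vt)// mulrC.
have := hd _ vtd; rewrite dot_setcr => H.
have -> : g (setc y s + setc v t) - g (setc y s) -
    (A 0 ord0 * c * v 0 ord0 + dot A (setc v 0)) =
  (g (setc y s + setc v t) - g (setc y s) - (A 0 ord0 * t + dot A (setc v 0))) +
   A 0 ord0 * (t - c * v 0 ord0) by ring.
rewrite (le_trans (cmodD _ _))// cmodM.
have H1 : cmod (A 0 ord0) * cmod (t - c * v 0 ord0) <= e / 2 * vnorm v.
  rewrite (le_trans (ler_wpM2l (cmod_ge0 _) ht))// mulrA.
  by rewrite ler_pM ?mulr_ge0 ?cmod_ge0// ltW.
have H2 : e / (2 * Kp) * vnorm (setc v t) <= e / 2 * vnorm v.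
  have -> : e / 2 * vnorm v = e / (2 * Kp) * (Kp * vnorm v) by field; rewrite gt_eqF.
  by rewrite ler_wpM2l// ltW.
lra.
Qed.

Let slice_ccont y : vnorm y < rho -> ccont (fun a => descend (setc y a)) 0.
Proof.
move=> yr e e0.
have y0 : vnorm (setc y 0) < r.
  by rewrite (le_lt_trans (vnorm_setc0 _))// (lt_trans yr)// (le_lt_trans rhoq).
have [A dA] := dg y0; have [d d0 hd] := vder_cont dA e0.
exists (Num.min rho (d ^+ k)); first by rewrite lt_min rho0 exprn_gt0.
move=> h; rewrite lt_min add0r => /andP[h1 h2].
have hk : (k.-root h) ^+ k = h by rewrite rootCK.
have zk : 0 ^+ k = 0 :> R[i] by rewrite expr0n gtn_eqF.
rewrite (descend_setc yr h1 hk) (descend_setc yr _ zk) ?cmod0//.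
rewrite (setc_line y (k.-root h)); apply: hd; rewrite vnormZ.
have -> : vnorm (setc 0 1 : 'rV[R[i]]_n.+1) = 1.
  apply/eqP; rewrite eq_le vnorm_setc_le ?vnorm0 ?cmod1//=.
  by have := cmod_vnorm (setc 0 1) ord0; rewrite setcE cmod1.
by rewrite mulr1 -(pow_lt _ k0 d0) hk.
Qed.

Let slice_cder y a : vnorm y < rho -> cmod a < rho ->
  exists b, cder (fun a => descend (setc y a)) a b.
Proof.
move=> yr.
have off z : cmod z < rho -> z != 0 -> exists b, cder (fun a => descend (setc y a)) z b.
  move=> zr z0; have zr' := dom_setc yr zr.
  have [|A] := descend_vder_off zr'; first by rewrite setcE.
  rewrite setc_line => /vder_line dA; exists (dot A (setc 0 1)).
  by apply: cder_ext dA; exists 1 => // h _; rewrite -setc_line.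
move=> ar; have [->|a0] := eqVneq a 0; last exact: off.
exact: (cder_removable rho0 (slice_ccont yr) off).
Qed.

Let L := 32 * M / r.
Let slice_lip y y' a : vnorm y < rho -> vnorm y' < rho -> cmod a < rho ->
  cmod (descend (setc y a) - descend (setc y' a)) <= L * vnorm (y - y').
Proof.
move=> yr yr' ar; pose s := k.-root a; have sk : s ^+ k = a by rewrite rootCK.
rewrite (descend_setc yr ar sk) (descend_setc yr' ar sk).
have sq : cmod s < q by rewrite -(pow_lt _ k0 q0) sk.
have h1 : vnorm (setc y s) <= q.
  by apply: vnorm_setc_le; apply: ltW => //; exact: lt_le_trans yr rhoq.
have h2 : vnorm (setc y' s) <= q.
  by apply: vnorm_setc_le; apply: ltW => //; exact: lt_le_trans yr' rhoq.
rewrite (le_trans (vder_lipschitz r0 dg gM h1 h2))// ler_wpM2l//.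
  rewrite /L divr_ge0 ?(ltW r0)// mulr_ge0//.
  by rewrite (le_trans (cmod_ge0 (g 0)))// gM// vnorm0.
by rewrite setcB subrr vnorm_setc0.
Qed.

(** Along [y_1] the derivative [b] comes from removability on the slice. In the other directions
    [descend] agrees with [g] on the hyperplane [y_1 = 0] and inherits [A]. A bound on the mixed
    term joins the two. *)
Lemma descend_vder_on y : vnorm y < rho -> y 0 ord0 = 0 -> exists A, vder descend y A.
Proof.
move=> yr y0.
have yE : setc y 0 = y by rewrite -{2}(setcK y) y0.
have z0 : cmod (0 : R[i]) < rho by rewrite cmod0.
have zk : 0 ^+ k = 0 :> R[i] by rewrite expr0n gtn_eqF.
have [b db] := slice_cder yr z0.
have [A dA] := dg (lt_trans (lt_le_trans yr rhoq) qr).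
have L0 : 0 <= L.
  rewrite /L divr_ge0 ?(ltW r0)// mulr_ge0//.
  by rewrite (le_trans (cmod_ge0 (g 0)))// gM// vnorm0.
exists (setc A b) => e e0; have e4 : 0 < e / 4 by lra.
have [d1 d10 hd1] := db _ e4; have [d2 d20 hd2] := dA _ e4.
pose K := 16 * (L + 1) / rho.
have K0 : 0 < K by rewrite /K divr_gt0// mulr_gt0//; lra.
pose dd := Num.min (Num.min d1 d2) (Num.min (rho / 4) (Num.min (rho - vnorm y) (e / 4 / K))).
have rho4 : 0 < rho / 4 by rewrite divr_gt0.
exists dd; first by rewrite !lt_min d10 d20 rho4 subr_gt0 yr; exact: divr_gt0.
move=> v; rewrite !lt_min => /andP[/andP[h1 h2] /andP[h3 /andP[h4 h5]]].
rewrite ltr_pdivlMr// in h5.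
pose a := v 0 ord0; have av : cmod a <= vnorm v := cmod_vnorm v ord0.
pose y' := y + v; have yr' : vnorm y' < rho by rewrite /y'; have := vnormD y v; lra.
have ar : cmod a < rho by lra.
have Ey' : setc y' a = y' by rewrite -{2}(setcK y') /y' mxE y0 add0r.
have vn := vnorm_ge0 v.
rewrite -/y' -{1}Ey' -{1}yE dot_setcl -/a.
have k1 := hd1 a (le_lt_trans av h1); rewrite add0r in k1.
have k2 : cmod (descend (setc y' 0) - descend (setc y 0) - dot A (setc v 0)) <= e / 4 * vnorm v.
  rewrite (descend_setc yr' z0 zk) (descend_setc yr z0 zk) yE.
  have -> : setc y' 0 = y + setc v 0 by rewrite -[in RHS]yE setcD addr0.
  rewrite (le_trans (hd2 _ _)) ?(le_lt_trans (vnorm_setc0 v))//.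
  by rewrite ler_wpM2l ?vnorm_setc0// ltW.
(* Mixed second difference: the slices at [y'] and [y] differ by O(|v|), and the
   Cauchy estimate gains a factor |a|. *)
have k3 : cmod ((descend (setc y' a) - descend (setc y a)) -
    (descend (setc y' 0) - descend (setc y 0))) <= e / 4 * vnorm v.
  have := @cder_lipschitz _ (fun a => descend (setc y' a) - descend (setc y a)) rho
    (L * vnorm v) rho0 _ _ a 0.
  rewrite subr0 => H.
  have {}H : cmod (descend (setc y' a) - descend (setc y a) - (descend (setc y' 0) - descend (setc y 0)))
     <= 16 * (L * vnorm v) / rho * cmod a.
    apply: H; last by rewrite cmod0; lra.
    - move=> z zr; have [b1 db1] := slice_cder yr' zr; have [b2 db2] := slice_cder yr zr.
      by exists (b1 - b2); exact: cderB.
    - move=> z zr; have := slice_lip yr' yr zr.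
      by rewrite (_ : y' - y = v)// /y' addrC addKr.
    - by rewrite (le_trans av)// ltW.
  rewrite (le_trans H)//.
  have -> : 16 * (L * vnorm v) / rho * cmod a = (16 * L / rho * cmod a) * vnorm v by ring.
  rewrite ler_wpM2r// (@le_trans _ _ (K * vnorm v))//; last by rewrite mulrC ltW.
  apply: ler_pM => //; rewrite ?cmod_ge0//.
    by apply: divr_ge0; [exact: mulr_ge0|exact: ltW rho0].
  by rewrite /K; apply: ler_wpM2r; [rewrite invr_ge0 ltW|lra].
have -> : descend (setc y' a) - descend (setc y 0) - (b * a + dot A (setc v 0)) =
  ((descend (setc y' a) - descend (setc y a)) - (descend (setc y' 0) - descend (setc y 0))) +
  (descend (setc y a) - descend (setc y 0) - b * a) +
  (descend (setc y' 0) - descend (setc y 0) - dot A (setc v 0)) by ring.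
rewrite (le_trans (cmodD _ _))//.
have := cmodD (descend (setc y' a) - descend (setc y a) - (descend (setc y' 0) - descend (setc y 0)))
  (descend (setc y a) - descend (setc y 0) - b * a).
have : e / 4 * cmod a <= e / 4 * vnorm v by rewrite ler_wpM2l// ltW.
have : 0 <= e / 4 * vnorm v by rewrite mulr_ge0// ltW.
lra.
Qed.

Lemma descend_factor : exists2 d : R, 0 < d &
  (forall y, vnorm y < d -> exists A, vder descend y A) /\
  (forall x, vnorm x < d -> descend (setc x (x 0 ord0 ^+ k)) = g x).
Proof.
exists rho => //; split=> [y yr|x xr].
  have [y0|y0] := eqVneq (y 0 ord0) 0; first exact: descend_vder_on.
  exact: descend_vder_off.
have xr0 := le_lt_trans (cmod_vnorm x ord0) xr.
rewrite (@descend_setc _ _ (x 0 ord0)) ?setcK//.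
have x1 : cmod (x 0 ord0) <= 1.
  by rewrite (le_trans (ltW xr0))// (le_trans rhoq)// /q; have := r1; have := r0; lra.
rewrite cmodX -(prednK k0) exprS (le_lt_trans _ xr0)//.
by rewrite ler_piMr ?cmod_ge0// exprn_ile1 ?cmod_ge0.
Qed.

End Factor.

Lemma invariant_factor k om g (r : R) : (0 < k)%N -> k.-primitive_root om -> 0 < r ->
  (forall x, vnorm x < r -> exists A, vder g x A) ->
  (forall x, vnorm x < r -> g (setc x (om * x 0 ord0)) = g x) ->
  exists2 d : R, 0 < d &
  (forall y, vnorm y < d -> exists A, vder (descend k g) y A) /\
  (forall x, vnorm x < d -> descend k g (setc x (x 0 ord0 ^+ k)) = g x).
Proof.
move=> k0 pom r0 dg gom.
have [|A dA] := dg 0; first by rewrite vnorm0.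
have [d d0 hd] := vder_cont dA ltr01.
pose r' := Num.min (Num.min r d) 1.
have r'r : r' <= r by rewrite !ge_min lexx.
have r'd : r' <= d by rewrite !ge_min lexx orbT.
have r'1 : r' <= 1 by rewrite !ge_min lexx orbT.
apply: (@descend_factor k om g r' (cmod (g 0) + 1)) => //.
- by rewrite !lt_min r0 d0 ltr01.
- by move=> x xr; apply: dg; exact: lt_le_trans r'r.
- move=> x xr; have := hd x (lt_le_trans xr r'd); rewrite add0r.
  by have := cmod_sub (g x) (g 0); lra.
- by move=> x xr; apply: gom; exact: lt_le_trans r'r.
Qed.

End FirstCoordinate.

(** * Functions whose k-th power is that of the first coordinate *)

Section ScaledCoordinate.
Variables (R : realType) (n : nat).
Implicit Types (x y v A : 'rV[R[i]]_n.+1) (g u : 'rV[R[i]]_n.+1 -> R[i]) (a b c s t om : R[i]).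

(* [f z / (c z)] takes values in the k-th roots of unity, at least [1 / k] apart,
   and is Lipschitz of constant 16: it is constant on the disc of radius [1 / (33 k)]. *)
Lemma cder_power_line (f : R[i] -> R[i]) k c a : (0 < k)%N -> c != 0 ->
  (forall z, cmod z < 1 -> exists b, cder f z b) -> cder f 0 a ->
  (forall z, cmod z < 1 -> f z ^+ k = (c * z) ^+ k) ->
  forall z, cmod z <= (33 * k)%:R^-1 -> f z = a * z.
Proof.
move=> k0 c0 df da fk.
have c1 : cmod (0 : R[i]) < 1 by rewrite cmod0.
have f0 : f 0 = 0.
  by have /eqP := fk 0 c1; rewrite mulr0 expr0n gtn_eqF// expf_eq0 k0 => /eqP.
pose V z := if z == 0 then a / c else f z / (c * z).
have Vk z : cmod z < 1 -> z != 0 -> V z ^+ k = 1.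
  by move=> z1 z0; rewrite /V (negPf z0) expr_div_n fk// divff// expf_neq0// mulf_neq0.
have cc : 0 < cmod c by rewrite cmod_gt0.
have Vc : ccont V 0.
  move=> e e0; have e1 : 0 < e * cmod c by rewrite mulr_gt0.
  have [d d0 hd] := da _ e1; exists d => // h hh; rewrite add0r /V eqxx.
  have [_|h0] := eqVneq h 0; first by rewrite subrr cmod0 ltW.
  have H := hd h hh; rewrite add0r f0 subr0 in H.
  have -> : f h / (c * h) - a / c = (f h - a * h) / (c * h) by field; rewrite h0 c0.
  rewrite cmodf cmodM ler_pdivrMr; last by rewrite mulr_gt0// cmod_gt0.
  by rewrite mulrA.
have Voff z : cmod z < 1 -> z != 0 -> exists b, cder V z b.
  move=> z1 z0; have [b db] := df z z1.
  have cz : 0 < cmod z by rewrite cmod_gt0.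
  pose b' := (b - f z / z) / (c * z); exists b' => e e0.
  have e1 : 0 < e * (cmod c * cmod z) / 4 by rewrite divr_gt0// !mulr_gt0.
  have [d d0 hd] := db _ e1.
  have B0 : 0 < 4 * (cmod b' + 1) by have := cmod_ge0 b'; lra.
  exists (Num.min d (Num.min (cmod z / 2) (e * cmod z / (4 * (cmod b' + 1))))).
    rewrite !lt_min d0 /=; apply/andP; split; first by rewrite divr_gt0.
    by apply: divr_gt0 => //; exact: mulr_gt0.
  move=> h; rewrite !lt_min => /and3P[/hd h1 h2]; rewrite ltr_pdivlMr// => h3.
  have czh : cmod z / 2 <= cmod (z + h) by have := cmodB (z + h) h; rewrite addrK; lra.
  have zh0 : z + h != 0 by rewrite -cmod_gt0 (lt_le_trans _ czh)// divr_gt0.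
  rewrite /V (negPf zh0) (negPf z0).
  have -> : f (z + h) / (c * (z + h)) - f z / (c * z) - b' * h =
    (f (z + h) - f z - b * h) / (c * (z + h)) - b' * h * h / (z + h).
    by rewrite /b'; field; rewrite z0 zh0 c0.
  clearbody b'.
  rewrite (le_trans (cmodB _ _))// !cmodf !cmodM.
  have czh0 : 0 < cmod (z + h) by rewrite cmod_gt0.
  have hh := cmod_ge0 h.
  have H1 : cmod (f (z + h) - f z - b * h) / (cmod c * cmod (z + h)) <= e / 2 * cmod h.
    rewrite ler_pdivrMr ?mulr_gt0//; rewrite (le_trans h1)//.
    have : e * cmod c * cmod h / 2 * (cmod z / 2) <= e * cmod c * cmod h / 2 * cmod (z + h).
      by rewrite ler_wpM2l// divr_ge0// !mulr_ge0// ltW.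
    lra.
  have H2 : cmod b' * cmod h * cmod h / cmod (z + h) <= e / 2 * cmod h.
    rewrite ler_pdivrMr//.
    have hb := cmod_ge0 b'.
    have : cmod b' * cmod h * cmod h <= e * cmod z / 4 * cmod h.
      by rewrite ler_wpM2r//; lra.
    have : e * cmod h / 2 * (cmod z / 2) <= e * cmod h / 2 * cmod (z + h).
      by rewrite ler_wpM2l// divr_ge0// mulr_ge0// ltW.
    lra.
  by rewrite (le_trans (lerD H1 H2))//; lra.
have VM z : cmod z < 1 -> cmod (V z) <= 1.
  move=> z1; have [->|z0] := eqVneq z 0; last by rewrite (cmod_unity k0 (Vk _ z1 z0)).
  apply: le_eps_le => e e0; have [d d0 hd] := Vc e e0.
  pose t := Num.min d 1 / 2.
  have m0 : 0 < Num.min d 1 by rewrite lt_min d0 ltr01.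
  have t0 : 0 < t by rewrite /t divr_gt0.
  have td : t < d.
    have : Num.min d 1 <= d by rewrite ge_min lexx.
    rewrite /t; lra.
  have t1 : t < 1.
    have : Num.min d 1 <= 1 by rewrite ge_min lexx orbT.
    rewrite /t; lra.
  have ct : cmod t%:C = t by rewrite cmod_real gtr0_norm.
  have tn0 : t%:C != 0 by rewrite -cmod_gt0 ct.
  have := hd t%:C; rewrite ct add0r cmodBC => /(_ td).
  have /(cmod_unity k0) : V t%:C ^+ k = 1 by apply: Vk => //; rewrite ct.
  by have := cmod_sub (V 0) (V t%:C); lra.
have dV z : cmod z < 1 -> exists b, cder V z b.
  move=> z1; have [->|z0] := eqVneq z 0; last exact: Voff.
  exact: (cder_removable ltr01 Vc Voff).
have Vlip := cder_lipschitz ltr01 dV VM.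
pose N := (33 * k)%N; have N0 : (0 : R) < N%:R by rewrite ltr0n muln_gt0.
have kR : (1 : R) <= k%:R by rewrite ler1n.
have NE : N%:R = 33 * k%:R :> R by rewrite natrM.
rewrite -/N; set ik : R := k%:R^-1; set iN : R := N%:R^-1.
have ik0 : 0 < ik by rewrite invr_gt0 ltr0n.
have iNk : iN = ik / 33 by rewrite /iN NE invfM mulrC.
have ik1 : ik <= 1 by rewrite invf_le1 ?ltr0n.
have iN0 : 0 < iN by rewrite iNk divr_gt0.
clearbody iN.
move=> z zN; have [->|z0] := eqVneq z 0; first by rewrite mulr0.
have z1 : cmod z < 1 by lra.
have VzE w : w != 0 -> cmod w <= iN -> V w = V z.
  move=> w0 wN; have w1 : cmod w < 1 by lra.
  apply: (unity_roots_gap k0); [exact: Vk|exact: Vk|].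
  have h1 : cmod w <= 1 / 4 by lra.
  have h2 : cmod z <= 1 / 8 by lra.
  rewrite (le_lt_trans (Vlip w z h1 h2))//.
  by rewrite -/ik; have := cmodB w z; lra.
(* [V 0] is a limit value, not known in advance to be a root of unity, so the comparison with it
   goes through continuity. *)
have V0z : V z = V 0.
  apply/eqP; rewrite -subr_eq0 -cmod_le0; apply: le_eps_le => e e0.
  have [d d0 hd] := Vc e e0.
  pose t := Num.min d iN / 2.
  have m0 : 0 < Num.min d iN by rewrite lt_min d0 iN0.
  have t0 : 0 < t by rewrite /t divr_gt0.
  have td : t < d.
    have : Num.min d iN <= d by rewrite ge_min lexx.
    rewrite /t; lra.
  have t1 : t <= iN.
    have : Num.min d iN <= iN by rewrite ge_min lexx orbT.
    rewrite /t; lra.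
  have ct : cmod t%:C = t by rewrite cmod_real gtr0_norm.
  have tn0 : t%:C != 0 by rewrite -cmod_gt0 ct.
  have := hd t%:C; rewrite ct add0r => /(_ td).
  by rewrite (VzE t%:C)// ?ct//; lra.
move: V0z; rewrite /V eqxx (negPf z0) => H.
have -> : f z = f z / (c * z) * (c * z) by field; rewrite z0 c0.
by rewrite H; field.
Qed.

(** On each complex line through 0 on which [x_1] is not identically 0, [u] is linear near 0 and
    equals its differential [dot A]. By homogeneity [dot A x ^+ k = x_1 ^+ k] for all [x] with
    [x_1 != 0], however large, which forces [dot A] to depend on [x_1] only. *)
Lemma scaled_coord u k (r : R) : (0 < k)%N -> 0 < r ->
  (forall x, vnorm x < r -> exists A, vder u x A) ->
  (forall x, vnorm x < r -> u x ^+ k = x 0 ord0 ^+ k) ->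
  exists2 om, om ^+ k = 1 & exists2 d : R, 0 < d &
    forall x, vnorm x < d -> u x = om * x 0 ord0.
Proof.
move=> k0 r0 du uk.
have [|A dA] := du 0; first by rewrite vnorm0.
pose N := (33 * k)%N; have N0 : (0 : R) < N%:R by rewrite ltr0n muln_gt0.
pose d := r / N%:R; have d0 : 0 < d by rewrite divr_gt0.
have NE : N%:R * d = r by rewrite /d mulrC divfK// gt_eqF.
have uA x : vnorm x < d -> x 0 ord0 != 0 -> u x = dot A x.
  (* Scaling by [N] places [x] at the parameter [1 / N], on the edge of the disc where
     [cder_power_line] applies. *)
  move=> xd x0; pose v := N%:R *: x.
  have vr : vnorm v < r by rewrite vnormZ cmod_nat -NE ltr_pM2l.
  have zv z : cmod z < 1 -> vnorm (0 + z *: v) < r.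
    move=> z1; rewrite add0r vnormZ (le_lt_trans _ vr)// ler_piMl ?vnorm_ge0//.
    exact: ltW.
  have v0 : v 0 ord0 != 0 by rewrite mxE mulf_neq0// pnatr_eq0 -lt0n muln_gt0.
  have NC : N%:R != 0 :> R[i] by rewrite pnatr_eq0 -lt0n muln_gt0.
  have := @cder_power_line (fun z => u (0 + z *: v)) k (v 0 ord0) (dot A v) k0 v0 _ _ _ N%:R^-1.
  rewrite add0r scalerA mulVf// scale1r => ->.
  - by rewrite dotZ mulrAC divff// mul1r.
  - by move=> z /zv zr; have [B dB] := du _ zr; exists (dot B v); exact: vder_line.
  - by apply: vder_line; rewrite scale0r addr0.
  - by move=> z /zv zr; rewrite uk// add0r mxE mulrC.
  - by rewrite cmodV cmod_nat.
have homog x : x 0 ord0 != 0 -> dot A x ^+ k = x 0 ord0 ^+ k.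
  move=> x0; pose t : R := d / (2 * (vnorm x + 1)).
  have x1 : 0 < vnorm x + 1 by have := vnorm_ge0 x; lra.
  have t0 : 0 < t by rewrite divr_gt0// mulr_gt0.
  have ct : cmod t%:C = t by rewrite cmod_real gtr0_norm.
  have tn0 : t%:C != 0 by rewrite -cmod_gt0 ct.
  have txd : vnorm (t%:C *: x) < d.
    have -> : d = t * (2 * (vnorm x + 1)) by rewrite /t divfK// gt_eqF// mulr_gt0.
    by rewrite vnormZ ct ltr_pM2l//; have := vnorm_ge0 x; lra.
  have txr : vnorm (t%:C *: x) < r.
    rewrite (lt_le_trans txd)// /d ler_pdivrMr// ler_peMr ?(ltW r0)//.
    by rewrite ler1n muln_gt0.
  have tx0 : (t%:C *: x) 0 ord0 != 0 by rewrite mxE mulf_neq0.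
  have := uk _ txr; rewrite (uA _ txd tx0) dotZ mxE !exprMn.
  by apply: mulfI; rewrite expf_neq0.
have dotE x : dot A x = A 0 ord0 * x 0 ord0.
  rewrite -{1}(setcK x) dot_setcr.
  suff -> : dot A (setc x 0) = 0 by rewrite addr0.
  apply/eqP; rewrite -cmod_le0; apply/negP => /negP; rewrite -ltNge => D0.
  pose D := cmod (dot A (setc x 0)).
  (* At the points with first coordinate 1 and remaining coordinates [i] times those of [x], [dot A]
     has modulus 1, yet it would grow linearly in [i]. *)
  have hi (i : nat) : i%:R * D <= 1 + cmod (A 0 ord0).
    have e1 : setc (i%:R *: x) 1 0 ord0 != 0 by rewrite setcE oner_neq0.
    have := homog _ e1; rewrite setcE expr1n => /(cmod_unity k0).
    rewrite dot_setcr mulr1.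
    have -> : setc (i%:R *: x) 0 = i%:R *: setc x 0 by rewrite setcZ mulr0.
    rewrite dotZ => H; have := cmodB (A 0 ord0 + i%:R * dot A (setc x 0)) (A 0 ord0).
    rewrite H (_ : A 0 ord0 + i%:R * dot A (setc x 0) - A 0 ord0 = i%:R * dot A (setc x 0)); last by ring.
    by rewrite cmodM cmod_nat.
  pose B := (1 + cmod (A 0 ord0)) / D.
  have B0 : 0 <= B by rewrite divr_ge0 ?addr_ge0 ?cmod_ge0.
  have := archi_boundP B0; rewrite /B ltr_pdivrMr// ltNge => /negP; apply.
  exact: hi.
have e1 : setc (0 : 'rV[R[i]]_n.+1) 1 0 ord0 != 0 by rewrite setcE oner_neq0.
have omk : A 0 ord0 ^+ k = 1.
  by have := homog _ e1; rewrite dotE setcE mulr1 expr1n.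
exists (A 0 ord0) => //; exists d => // x xd.
have [x0|x0] := eqVneq (x 0 ord0) 0; last by rewrite (uA x xd x0) dotE.
have xr : vnorm x < r.
  rewrite (lt_le_trans xd)// /d ler_pdivrMr// ler_peMr ?(ltW r0)//.
  by rewrite ler1n muln_gt0.
have := uk x xr; rewrite x0 mulr0 expr0n gtn_eqF//= => /eqP.
by rewrite expf_eq0 k0 => /eqP.
Qed.

End ScaledCoordinate.

(** * Germs *)

Section Bridge.
Variables (R : realType) (n : nat).
Implicit Types (x v : 'CC[R]_n).

Lemma gt0_complexP (e : R[i]) : 0 < e -> exists2 t : R, 0 < t & e = t%:C.
Proof. by case: e => a b; rewrite ltcE /= => /andP[/eqP -> a0]; exists a. Qed.

Lemma mx_norm_vnorm x : `|x| = (vnorm x)%:C.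
Proof.
have le1 j : `|x 0 j| <= `|x|.
  rewrite -[leRHS]/(mx_norm x) mx_normE -[leLHS]nngE num_le.
  exact: (@le_bigmax _ _ _ _ (fun i => `|x i.1 i.2|%:nng) (0, j)).
apply/eqP; rewrite eq_le; apply/andP; split.
  have [->|x0] := eqVneq `|x| 0; first by rewrite ler0c vnorm_ge0.
  have [[i j] /= ->] : exists i, `|x| = `|x i.1 i.2| by exact: mx_norm_neq0 x0.
  by rewrite (ord1 i) normE lecR cmod_vnorm.
have [->|x0] := eqVneq x 0; first by rewrite vnorm0 normr0.
have : 0 < `|x| by rewrite normr_gt0.
move=> /gt0_complexP[t t0 xt]; rewrite xt lecR; apply: vnorm_le => [|j].
  exact: ltW.
by rewrite -lecR -xt -normE.
Qed.

Lemma near0P (P : 'CC[R]_n -> Prop) :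
  (\forall x \near (0 : 'CC[R]_n), P x) <->
  exists2 e : R, 0 < e & forall x, vnorm x < e -> P x.
Proof.
rewrite nbhs_norm0P; split=> [[_ /= /gt0_complexP[e e0 ->]] eP|[e e0 eP]].
  by exists e => // x xe; apply: eP; rewrite /= mx_norm_vnorm ltcR.
exists e%:C; first by rewrite /= ltcR.
by move=> x /=; rewrite mx_norm_vnorm ltcR; exact: eP.
Qed.

Lemma dot_row (A v : 'CC[R]_n) (B : 'M[R[i]]_n) j : (forall i, B i j = A 0 i) ->
  (v *m B) 0 j = dot A v.
Proof. by move=> BA; rewrite mxE; apply: eq_bigr => i _; rewrite BA mulrC. Qed.

Lemma differentiable_vder (f : 'CC[R]_n -> 'CC[R]_n) x : differentiable f x ->
  forall j, exists A, vder (fun y => f y 0 j) x A.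
Proof.
move=> /diff_locallyP[_ /eqaddoP fo] j.
exists (\row_i ('d f x (delta_mx 0 i) 0 j)) => e e0.
have eC : 0 < e%:C :> R[i] by rewrite ltcR.
have /near0P[d d0 hd] := fo _ eC.
exists d => // v /hd.
rewrite /= !mx_norm_vnorm -(rmorphM (real_complex R)) /= lecR.
apply: le_trans; apply: le_trans (cmod_vnorm _ j).
rewrite le_eqVlt; apply/orP; left; apply/eqP; congr cmod.
rewrite [x + v]addrC.
have -> : dot (\row_i ('d f x (delta_mx 0 i) 0 j)) v = 'd f x v 0 j.
  rewrite {2}(row_sum_delta v) linear_sum summxE; apply: eq_bigr => i _.
  by rewrite linearZ !mxE mulrC.
by rewrite !mxE opprD addrA.
Qed.

Lemma vder_differentiable (f : 'CC[R]_n -> 'CC[R]_n) x :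
  (forall j, exists A, vder (fun y => f y 0 j) x A) -> differentiable f x.
Proof.
move=> /choice[A dA]; pose B : 'M[R[i]]_n := \matrix_(i, j) A j 0 i.
have BA j v : (v *m B) 0 j = dot (A j) v by apply: dot_row => i; rewrite mxE.
have /choice[K hK] : forall j, exists K : R, 0 < K /\ forall v, cmod (dot (A j) v) <= K * vnorm v.
  by move=> j; have [K K0 hK] := dot_le (A j); exists K.
pose V : normedModType R[i] := 'CC[R]_n.
pose df : {linear V -> V} := mulmxr B.
have Bc : continuous df.
  apply: bounded_linear_continuous; apply/ex_bound.
  exists (\sum_j K j)%:C; apply/near0P; exists 1 => // v v1 /=.
  rewrite mx_norm_vnorm lecR; apply: vnorm_le.
    by apply: sumr_ge0 => j _; exact: ltW (hK j).1.
  move=> j; rewrite BA (le_trans ((hK j).2 v))//.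
  rewrite (@le_trans _ _ (K j))//; first by rewrite ler_piMr ?ltW// (hK j).1.
  by rewrite (bigD1 j)//= lerDl sumr_ge0// => i _; exact: ltW (hK i).1.
have fo : (f : V -> V) \o shift x = cst (f x) + df +o_ (0 : V) id.
  apply/eqaddoP => e /gt0_complexP[t t0 ->].
  have /choice[d hd] : forall j, exists d : R, 0 < d /\ forall v, vnorm v < d ->
     cmod (f (x + v) 0 j - f x 0 j - dot (A j) v) <= t * vnorm v.
    by move=> j; have [d d0 hd] := dA j t t0; exists d.
  apply/near0P; exists (\big[Order.min/1]_j d j).
    by apply/bigmin_gtP; split=> // j _; exact: (hd j).1.
  move=> v vd; rewrite !mx_norm_vnorm -(rmorphM (real_complex R)) /= lecR.
  apply: vnorm_le => [|j]; first by rewrite mulr_ge0 ?vnorm_ge0 ?ltW.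
  have vdj : vnorm v < d j by rewrite (lt_le_trans vd)// bigmin_le.
  have := (hd j).2 v vdj; rewrite -BA [x + v]addrC; congr (cmod _ <= _).
  by rewrite !mxE opprD addrA.
apply/diff_locallyP; have -> : 'd (f : V -> V) x = df :> (V -> V).
  exact: diff_unique.
by split.
Qed.

End Bridge.

Section Germs.
Variables (R : realType) (n : nat).
Local Notation V := 'CC[R]_n.
Implicit Types (u v f g phi : V -> V).

(** Convergence to 0 at 0, phrased as the right to substitute [u x] in an identity of germs. It also
    covers [root_fold], of which nothing more than this is asked. *)
Definition tends_to0 u := forall P : V -> Prop,
  (\forall x \near (0 : V), P x) -> \forall x \near (0 : V), P (u x).

Lemma near0W (P : V -> Prop) : (forall x, P x) -> \forall x \near (0 : V), P x.
Proof. by move=> PT; apply/near0P; exists 1. Qed.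

Lemma holo_germ_tends_to0 u : holo_germ u -> tends_to0 u.
Proof.
move=> [u0 du] P nP.
have /differentiable_continuous : differentiable u (0 : V) := nbhs_singleton du.
by rewrite /prop_for /continuous_at u0 => /(_ P); exact.
Qed.

Lemma holo_germ_comp u v : holo_germ u -> holo_germ v -> holo_germ (v \o u).
Proof.
move=> hu hv; split; first by rewrite /= hu.1 hv.1.
have := holo_germ_tends_to0 hu hv.2; have := hu.2; apply: filterS2 => x du dv.
exact: differentiable_comp.
Qed.

Lemma holo_germ_iter m u : holo_germ u -> holo_germ (iter m u).
Proof.
move=> hu; elim: m => [|m IH]; last exact: holo_germ_comp IH hu.
by split => //; apply: near0W => x; have [] := @is_diff_id _ V x; exact.
Qed.

Lemma biholo_germ_cancel l : biholo_germ l -> exists2 l' : V -> V, holo_germ l' & germ_eq (l' \o l) id.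
Proof. by move=> [l' [_ hl' ll' _]]; exists l'. Qed.

Lemma L_equivalent_associated f g phi : holo_germ g -> holo_germ phi ->
  L_equivalent g f -> associated f phi -> associated g phi.
Proof.
move=> hg hphi [l /biholo_germ_cancel[l' hl' ll'] fl] fphi.
have e1 := holo_germ_tends_to0 hphi fl.
have e2 := holo_germ_tends_to0 hg ll'.
have e3 := holo_germ_tends_to0 (holo_germ_comp hphi hg) ll'.
near=> x => /=.
have : l' (l (g (phi x))) = g (phi x) by exact: (near e3 x).
have <- : f (phi x) = l (g (phi x)) by exact: (near e1 x).
have -> : f (phi x) = f x by exact: (near fphi x).
have -> : f x = l (g x) by exact: (near fl x).
by move=> <-; have : l' (l (g x)) = g x by exact: (near e2 x).
Unshelve. all: by end_near. Qed.

End Germs.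

(** * Folds: local sections, descent and lifting *)

Section Folds.
Variables (R : realType) (n : nat).
Local Notation V := 'CC[R]_n.+1.
Implicit Types (u v f g phi : V -> V).

Lemma std_foldE k (x : V) : std_fold k x = setc x (x 0 ord0 ^+ k).
Proof.
apply/rowP => j; rewrite !mxE.
by have -> : (val j == 0%N) = (j == ord0) by []; case: eqP => // ->.
Qed.

Lemma std_fold_tends_to0 k : (0 < k)%N -> tends_to0 (@std_fold R n.+1 k).
Proof.
move=> k0 P /near0P[e e0 eP]; apply/near0P; exists (Num.min e 1).
  by rewrite lt_min e0 ltr01.
move=> x; rewrite lt_min => /andP[xe x1]; apply: eP; rewrite std_foldE.
apply: vnorm_setc_lt => //.
have x0 := cmod_vnorm x ord0.
rewrite cmodX -(prednK k0) exprS (le_lt_trans _ (le_lt_trans x0 xe))//.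
by rewrite ler_piMr ?cmod_ge0// exprn_ile1 ?cmod_ge0// (le_trans x0)// ltW.
Qed.

Definition root_fold k (x : V) := setc x (k.-root (x 0 ord0)).

Lemma root_foldK k (x : V) : (0 < k)%N -> std_fold k (root_fold k x) = x.
Proof. by move=> k0; rewrite std_foldE setc_setc setcE rootCK// setcK. Qed.

Lemma root_fold_tends_to0 k : (0 < k)%N -> tends_to0 (root_fold k).
Proof.
move=> k0 P /near0P[e e0 eP]; apply/near0P; exists (Num.min e (e ^+ k)).
  by rewrite lt_min e0 exprn_gt0.
move=> x; rewrite lt_min => /andP[xe xek]; apply: eP.
apply: vnorm_setc_lt => //; rewrite -(pow_lt _ k0 e0) rootCK//.
exact: le_lt_trans (cmod_vnorm x ord0) xek.
Qed.

(** Local surjectivity in the form that cancels a fold on the right of an identity of germs. *)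
Lemma kfold_section k g : kfold k g -> exists2 s : V -> V, tends_to0 s & germ_eq (g \o s) id.
Proof.
move=> [k2 hg [h [h' [l [[hh hh' hh'K hK] [l' [hl hl' ll' l'l]] ge]]]]].
have k0 : (0 < k)%N by exact: ltnW.
exists (h \o root_fold k \o l').
  move=> P /(holo_germ_tends_to0 hh)/(root_fold_tends_to0 k0)/(holo_germ_tends_to0 hl'); exact.
have e1 := holo_germ_tends_to0 hl' (root_fold_tends_to0 k0 (holo_germ_tends_to0 hh ge)).
have e2 := holo_germ_tends_to0 hl' (root_fold_tends_to0 k0 hh'K).
near=> y => /=.
rewrite [LHS](near e1 y)//=.
have -> : h' (h (root_fold k (l' y))) = root_fold k (l' y) by exact: (near e2 y).
by rewrite root_foldK//; exact: (near l'l y).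
Unshelve. all: by end_near. Qed.

Lemma holo_descend k om (G : V -> V) : (0 < k)%N -> k.-primitive_root om -> holo_germ G ->
  (\forall x \near (0 : V), G (setc x (om * x 0 ord0)) = G x) ->
  exists2 H : V -> V, holo_germ H & \forall x \near (0 : V), H (std_fold k x) = G x.
Proof.
move=> k0 pom [G0 dG] Gom.
pose H (y : V) : V := \row_j descend k (fun x => G x 0 j) y.
have Hj j : (\forall y \near (0 : V), exists A, vder (fun x => H x 0 j) y A) /\
     (\forall x \near (0 : V), H (std_fold k x) 0 j = G x 0 j).
  have dGj : \forall x \near (0 : V), exists A, vder (fun x => G x 0 j) x A.
    by apply: filterS dG => x /differentiable_vder.
  have /near0P[r r0 hr] : \forall x \near (0 : V), (exists A, vder (fun x => G x 0 j) x A) /\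
      G (setc x (om * x 0 ord0)) = G x by exact: filterI dGj Gom.
  have [|x xr|d d0 [h1 h2]] := @invariant_factor _ _ k om (fun x => G x 0 j) r k0 pom r0.
  - by move=> x /hr[].
  - by have [_ ->] := hr x xr.
  have HE : (fun x => H x 0 j) = descend k (fun x => G x 0 j).
    by apply/funext => y; rewrite mxE.
  split; apply/near0P; exists d => // x xd; first by rewrite HE; exact: h1.
  by rewrite std_foldE mxE h2.
have HG : \forall x \near (0 : V), H (std_fold k x) = G x.
  have : \forall x \near (0 : V), forall j, H (std_fold k x) 0 j = G x 0 j.
    exact: (@filter_forall V 'I_n.+1 (fun j x => H (std_fold k x) 0 j = G x 0 j) (nbhs (0 : V)) _ (fun j => (Hj j).2)).
  by apply: filterS => x hx; apply/rowP.
exists H => //; split.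
  have f0 : std_fold k (0 : V) = 0.
    by apply/rowP => j; rewrite std_foldE !mxE expr0n gtn_eqF//; case: eqP.
  by have := nbhs_singleton HG; rewrite f0 G0.
have : \forall y \near (0 : V), forall j, exists A, vder (fun x => H x 0 j) y A.
  exact: (@filter_forall V 'I_n.+1 (fun j y => exists A, vder (fun x => H x 0 j) y A) (nbhs (0 : V)) _ (fun j => (Hj j).1)).
by apply: filterS => y; exact: vder_differentiable.
Qed.

(** Stated for any invariant holomorphic [g], so that it applies in both directions between two
    folds. *)
Lemma kfold_lift k f g phi : kfold k f -> holo_germ phi -> germ_order k phi ->
  associated f phi -> holo_germ g -> associated g phi ->
  exists2 M : V -> V, holo_germ M & germ_eq g (M \o f).
Proof.
move=> [k2 hf [h [h' [l [[hh hh' h'h hK] [l' [hl hl' ll' l'l]] fe]]]]] hphi [_ _ nord] fphi hg gphi.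
have k0 : (0 < k)%N by exact: ltnW.
pose psi := h' \o phi \o h.
have hphih : holo_germ (phi \o h) by exact: holo_germ_comp.
have hpsi : holo_germ psi by exact: (holo_germ_comp hphih hh').
have std_psi : \forall x \near (0 : V), std_fold k (psi x) = std_fold k x.
  have e1 := holo_germ_tends_to0 hh fphi.
  have e2 := holo_germ_tends_to0 hphih fe.
  have e3 := holo_germ_tends_to0 hh fe.
  have e4 := holo_germ_tends_to0 hpsi (std_fold_tends_to0 k0 ll').
  have e5 := std_fold_tends_to0 k0 ll'.
  near=> x.
  have <- : l' (l (std_fold k (psi x))) = std_fold k (psi x) by exact: (near e4 x).
  have <- : f (phi (h x)) = l (std_fold k (psi x)) by exact: (near e2 x).
  have -> : f (phi (h x)) = f (h x) by exact: (near e1 x).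
  have -> : f (h x) = l (std_fold k (h' (h x))) by exact: (near e3 x).
  have -> : h' (h x) = x by exact: (near h'h x).
  exact: (near e5 x).
have [om omk psiE] : exists2 om : R[i], om ^+ k = 1 &
    \forall x \near (0 : V), psi x = setc x (om * x 0 ord0).
  have dpsi : \forall x \near (0 : V), exists A, vder (fun x => psi x 0 ord0) x A.
    by apply: filterS hpsi.2 => x /differentiable_vder.
  have /near0P[r r0 hr] : \forall x \near (0 : V),
      (exists A, vder (fun x => psi x 0 ord0) x A) /\ std_fold k (psi x) = std_fold k x.
    exact: filterI dpsi std_psi.
  have [|x xr|om omk [d d0 hd]] := @scaled_coord _ _ (fun x => psi x 0 ord0) k r k0 r0.
  - by move=> x /hr[].
  - by have [_ /(congr1 (fun y : V => y 0 ord0))] := hr x xr; rewrite !std_foldE !setcE.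
  exists om => //; have nd : \forall x \near (0 : V), vnorm x < d by apply/near0P; exists d.
  (* The coordinates other than the first are left unchanged by [psi] because the standard fold
     retains them. *)
  near=> x; apply/rowP => j; rewrite mxE; case: ifPn => [/eqP ->|j0].
    by apply: hd; near: x.
  have /(congr1 (fun y : V => y 0 j)) : std_fold k (psi x) = std_fold k x by near: x.
  by rewrite !std_foldE !mxE (negPf j0).
have hpsiE : \forall x \near (0 : V), h (psi x) = phi (h x).
  exact: (holo_germ_tends_to0 hphih hK).
have pom : k.-primitive_root om.
  have [m pm mk] := prim_order_exists k0 omk.
  have m0 := prim_order_gt0 pm.
  (* If [om] had order [m < k], the [m]-th iterate of [psi], hence that of its conjugate [phi],
     would be the identity germ. *)
  have := dvdn_leq k0 mk; rewrite leq_eqVlt => /orP[/eqP <-//|ltmk].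
  exfalso; apply: (nord m); first by rewrite m0.
  have iter_psi i : \forall x \near (0 : V), iter i psi x = setc x (om ^+ i * x 0 ord0).
    elim: i => [|i IH]; first by apply: near0W => x; rewrite expr0 mul1r setcK.
    have e1 := holo_germ_tends_to0 (holo_germ_iter i hpsi) psiE.
    near=> x.
    have -> : iter i.+1 psi x = setc (iter i psi x) (om * iter i psi x 0 ord0).
      exact: (near e1 x).
    have -> : iter i psi x = setc x (om ^+ i * x 0 ord0) by near: x.
    by rewrite setc_setc setcE mulrA -exprS.
  have iter_phi i : \forall x \near (0 : V), iter i phi (h x) = h (iter i psi x).
    elim: i => [|i IH]; first by apply: near0W.
    have e1 := holo_germ_tends_to0 (holo_germ_iter i hpsi) hpsiE.
    near=> x => /=.
    have -> : iter i phi (h x) = h (iter i psi x) by near: x.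
    by apply/esym; exact: (near e1 x).
  have e1 := holo_germ_tends_to0 hh' (iter_psi m).
  have e2 := holo_germ_tends_to0 hh' (iter_phi m).
  near=> y.
  have hy : h (h' y) = y by exact: (near hK y).
  have : iter m phi (h (h' y)) = h (iter m psi (h' y)) by exact: (near e2 y).
  have -> : iter m psi (h' y) = setc (h' y) (om ^+ m * h' y 0 ord0) by exact: (near e1 y).
  by rewrite (prim_expr_order pm) mul1r setcK hy.
have hG : holo_germ (g \o h) by exact: holo_germ_comp.
have Gom : \forall x \near (0 : V), (g \o h) (setc x (om * x 0 ord0)) = (g \o h) x.
  have e1 := holo_germ_tends_to0 hh gphi.
  near=> x => /=.
  have <- : psi x = setc x (om * x 0 ord0) by near: x.
  have -> : h (psi x) = phi (h x) by near: x.
  exact: (near e1 x).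
have [H hH HE] := holo_descend k0 pom hG Gom.
exists (H \o l'); first exact: holo_germ_comp.
have e1 := holo_germ_tends_to0 hh' (std_fold_tends_to0 k0 ll').
have e2 := holo_germ_tends_to0 hh' HE.
near=> y => /=.
have -> : f y = l (std_fold k (h' y)) by exact: (near fe y).
have -> : l' (l (std_fold k (h' y))) = std_fold k (h' y) by exact: (near e1 y).
have -> : H (std_fold k (h' y)) = g (h (h' y)) by exact: (near e2 y).
by have -> : h (h' y) = y by exact: (near hK y).
Unshelve. all: by end_near. Qed.

Lemma associated_L_equivalent k f g phi : kfold k f -> kfold k g ->
  holo_germ phi -> germ_order k phi ->
  associated f phi -> associated g phi -> L_equivalent g f.
Proof.
move=> kf kg hphi ophi fphi gphi.
have hf : holo_germ f by case: kf.
have hg : holo_germ g by case: kg.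
have [M hM gM] := kfold_lift kf hphi ophi fphi hg gphi.
have [M' hM' fM'] := kfold_lift kg hphi ophi gphi hf fphi.
have [sf sf0 sfK] := kfold_section kf.
have [sg sg0 sgK] := kfold_section kg.
exists M' => //; exists M; split => //.
  (* Writing [y = g (sg y)], one gets [M (M' y) = M (f (sg y)) = g (sg y) = y]. *)
  have e1 := sg0 _ gM; have e2 := sg0 _ fM'.
  near=> y => /=.
  have gs : g (sg y) = y by exact: (near sgK y).
  have : f (sg y) = M' (g (sg y)) by exact: (near e2 y).
  by rewrite gs => <-; rewrite -[RHS]gs; apply/esym; exact: (near e1 y).
have e1 := sf0 _ gM; have e2 := sf0 _ fM'.
near=> y => /=.
have fs : f (sf y) = y by exact: (near sfK y).
have : g (sf y) = M (f (sf y)) by exact: (near e1 y).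
by rewrite fs => <-; rewrite -[RHS]fs; apply/esym; exact: (near e2 y).
Unshelve. all: by end_near. Qed.

End Folds.

Theorem theorem3p3 (R : realType) (k n : nat) (hk : (2 <= k)%N) (hn : (2 <= n)%N)
    (f phi : 'CC[R]_n -> 'CC[R]_n)
    (hf : kfold k f) (hphi : reflection phi) (hord : germ_order k phi)
    (hassoc : associated f phi)
    (g : 'CC[R]_n -> 'CC[R]_n) (hg : kfold k g) :
  associated g phi <-> L_equivalent g f.
Proof.
have [phi' [hphi0 _ _ _]] : biholo_germ phi by case: hphi.
case: n hn f phi hf hphi hord hassoc g hg phi' hphi0 => [//|n] _ f phi hf _ hord hassoc g hg _ hphi.
split=> [gphi|fg]; first exact: associated_L_equivalent hf hg hphi hord hassoc gphi.
by apply: L_equivalent_associated fg hassoc => //; case: hg.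
Qed.
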